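(* Let $r\in(0,\infty)$ and let $P$ be an absolutely continuous Borel probability on $\mathbb{R}^d$ whose density is essentially bounded, whose support $\operatorname{supp}(P)$ is connected and compact, and which is peakless in the following sense: there exist $c>0$ and $s_0>0$ such that $$P(B(x,s))\ge c\,\lambda^d(B(x,s))\qquad\text{for all } s\in(0,s_0) \text{ and all } x\in\operatorname{supp}(P).$$ Let $(\alpha_n)_{n\in\mathbb{N}}$ be a sequence of $n$-optimal codebooks of order $r$ for $P$. For $a\in\alpha_n$ define the inradius and the circumradius of the Voronoi cell $W(a\mid\alpha_n)$ by $$\underline{s}_{n,a}=\sup\{s>0 : B(a,s)\subset W(a\mid\alpha_n)\},\qquad \overline{s}_{n,a}=\inf\{s>0 : W(a\mid\alpha_n)\cap\operatorname{supp}(P)\subset B(a,s)\},$$ respectively. Then $$\frac1n\preccurlyeq\min_{a\in\alpha_n}P(W_0(a\mid\alpha_n))\le\max_{a\in\alpha_n}P(W(a\mid\alpha_n))\preccurlyeq\frac1n,$$ $$\frac{e_{n,r}^r}{n}\preccurlyeq\min_{a\in\alpha_n}\int_{W_0(a\mid\alpha_n)}\|x-a\|^r\,dP(x)\le\max_{a\in\alpha_n}\int_{W(a\mid\alpha_n)}\|x-a\|^r\,dP(x)\preccurlyeq\frac{e_{n,r}^r}{n},$$ and $$n^{-1/d}\preccurlyeq\min_{a\in\alpha_n}\underline{s}_{n,a}\le\max_{a\in\alpha_n}\overline{s}_{n,a}\preccurlyeq n^{-1/d}.$$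
   Context: $\|\cdot\|$ is an arbitrary fixed norm on $\mathbb{R}^d$, $d\ge1$; $\lambda^d$ is Lebesgue measure; $B(x,s)=\{y:\|y-x\|<s\}$; $d(x,A)=\inf_{a\in A}\|x-a\|$ with $d(x,\varnothing)=+\infty$. The $n$th-level quantization error $e_{n,r}$ is given by $e_{n,r}^r=\inf\{\int d(x,\alpha)^r\,dP(x):\alpha\subset\mathbb{R}^d,\ 1\le\operatorname{card}(\alpha)\le n\}$. An $n$-optimal codebook of order $r$ for $P$ is a set $\alpha_n\subset\mathbb{R}^d$ with $\operatorname{card}(\alpha_n)\le n$ and $\int d(x,\alpha_n)^r\,dP(x)=e_{n,r}^r$ (such sets exist and have exactly $n$ elements). For $a\in\alpha_n$, $W(a\mid\alpha_n)=\{x\in\mathbb{R}^d:\|x-a\|=d(x,\alpha_n)\}$ and $W_0(a\mid\alpha_n)=\{x\in\mathbb{R}^d:\|x-a\|<d(x,\alpha_n\setminus\{a\})\}$. For sequences, $a_n\preccurlyeq b_n$ means that $(a_n/b_n)$ is bounded from above.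
   Formalization: The inequality min of the inradii ≤ max of the circumradii is stated only for n ≥ 2, since for n = 1 the Voronoi cell is all of R^d, with infinite inradius but finite circumradius (compact support), so the claim is false there. *)

(* Defs.v *)
From HB Require Import structures.
From mathcomp Require Import all_boot all_order all_algebra finmap.
From mathcomp Require Import all_classical all_reals all_analysis.
From mathcomp Require Import measurable_realfun ess_sup_inf.

Set Implicit Arguments.
Unset Strict Implicit.
Unset Printing Implicit Defensive.

Import Order.TTheory GRing.Theory Num.Theory.
Import numFieldNormedType.Exports.

Local Open Scope classical_set_scope.
Local Open Scope ring_scope.

(* R^d is 'rV[R]_d with its standard topology and its Borel sigma-algebra. *)
Section borel_rV.
Context {R : realType} {d : nat}.

HB.instance Definition _ := @isMeasurable.Build (sigma_display (@open 'rV[R]_d))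
  'rV[R]_d <<s @open 'rV[R]_d >>
  (@sigma_algebra0 _ setT _) (@sigma_algebraC _ _)
  (@sigma_algebra_bigcup _ setT _).

Lemma open_measurable_rV (U : set 'rV[R]_d) : open U -> measurable U.
Proof. exact: sub_sigma_algebra. Qed.

End borel_rV.

Lemma measurable_coord {R : realType} d (i : 'I_d) :
  measurable_fun setT (fun v : 'rV[R]_d => v 0 i : measurableTypeR R).
Proof.
apply: (measurability _ (RGenOpens.measurableE R)).
move=> _ [_ [a [b ->] <-]]; rewrite setTI; apply: open_measurable_rV.
apply: open_comp; last exact: interval_open.
by move=> v _; exact: coord_continuous.
Qed.

(* The library's canonical sigma-finite instance of \x is shadowed by the one for
   subprobabilities, hence this explicit lemma. *)
Lemma product_sigma_finite d1 d2 (T1 : measurableType d1)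
    (T2 : measurableType d2) (R : realType)
    (m1 : {sigma_finite_measure set T1 -> \bar R})
    (m2 : {sigma_finite_measure set T2 -> \bar R}) :
  sigma_finite setT (m1 \x m2)%E.
Proof.
have /sigma_finiteP[F [FT ndF Foo]] := sigma_finiteT m1.
have /sigma_finiteP[G [GT ndG Goo]] := sigma_finiteT m2.
exists (fun n => F n `*` G n).
  rewrite -setXTT FT GT; apply/seteqP; split=> -[x y] /=.
    move=> [[n _ Fnx] [k _ Gky]]; exists (maxn n k) => //; split.
    - by move: x Fnx; exact/subsetPset/ndF/leq_maxl.
    - by move: y Gky; exact/subsetPset/ndG/leq_maxr.
  by move=> [n _ [/= ? ?]]; split; exists n.
move=> k; have [? ?] := Foo k; have [? ?] := Goo k.
split; first exact: measurableX.
by rewrite product_measure1E// lte_mul_pinfty// ge0_fin_numE.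
Qed.

Lemma sigma_finite_measureP d (T : measurableType d) (R : realType)
    (mu : set T -> \bar R) :
  mu set0 = 0%E -> (forall A, (0 <= mu A)%E) -> semi_sigma_additive mu ->
  sigma_finite setT mu ->
  exists nu : {sigma_finite_measure set T -> \bar R}, mu = nu.
Proof.
move=> mu0 mu_ge0 mu_sigma mu_sf.
pose m1 := isMeasure.Build _ _ _ mu mu0 mu_ge0 mu_sigma.
pose muM : {measure set T -> \bar R} := HB.pack mu m1.
pose m2 := @Measure_isSigmaFinite.Build _ _ _ muM mu_sf.
pose muS : {sigma_finite_measure set T -> \bar R} := HB.pack mu m1 m2.
by exists muS.
Qed.

Section lebesgue_measure_rV.
Context {R : realType}.

Definition consr d (p : measurableTypeR R * 'rV[R]_d) : 'rV[R]_d.+1 :=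
  \row_j oapp (fun k => p.2 0 k) p.1 (unlift ord0 j).

Fixpoint lebesgue_measure_rV d : set 'rV[R]_d -> \bar R :=
  match d return set 'rV[R]_d -> \bar R with
  | 0 => \d_(0 : 'rV[R]_0)
  | d'.+1 => pushforward (lebesgue_measure \x @lebesgue_measure_rV d')%E
               (@consr d')
  end.

Definition unconsr d (v : 'rV[R]_d.+1) : measurableTypeR R * 'rV[R]_d :=
  (v 0 ord0, \row_j v 0 (lift ord0 j)).

Lemma consr0 d (p : measurableTypeR R * 'rV[R]_d) : consr p 0 ord0 = p.1.
Proof. by rewrite mxE unlift_none. Qed.

Lemma consrS d (p : measurableTypeR R * 'rV[R]_d) j :
  consr p 0 (lift ord0 j) = p.2 0 j.
Proof. by rewrite mxE liftK. Qed.

Lemma unconsrK d : cancel (@unconsr d) (@consr d).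
Proof.
by move=> v; apply/rowP => j; case: (unliftP ord0 j) => [k|] ->;
  rewrite ?consr0 ?consrS// mxE.
Qed.

Lemma consrK d : cancel (@consr d) (@unconsr d).
Proof.
move=> [x v]; rewrite /unconsr consr0; congr pair.
by apply/rowP => j; rewrite mxE consrS.
Qed.

Lemma measurable_consr d : measurable_fun setT (@consr d).
Proof.
apply: (@measurability _ _ _ _ _ _ (@open 'rV[R]_d.+1)) => //.
move=> _ [U oU <-]; rewrite setTI.
pose F (qk : 'rV[rat]_d.+1 * nat) : set 'rV[R]_d.+1 :=
  ball (map_mx ratr qk.1 : 'rV[R]_d.+1) (qk.2.+1%:R^-1 : R).
have -> : U = \bigcup_(qk in [set qk | F qk `<=` U]) F qk.
  rewrite eqEsubset; split=> [v Uv|v [qk /= FU Fv]]; last exact: FU.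
  have /nbhs_ballP[e /= e0 veU] : nbhs v U by exact: open_nbhs_nbhs.
  have e20 : 0 < e / 2 by exact: divr_gt0.
  have [k ke] : exists k : nat, k.+1%:R^-1 < e / 2.
    exists (Num.truncn (e / 2)^-1); rewrite invf_plt ?posrE//.
    by have := truncnS_gt (e / 2)^-1.
  have k0 : (0 : R) < k.+1%:R^-1 by rewrite invr_gt0.
  have Q j : exists q : rat, ball (v 0 j) k.+1%:R^-1 (ratr q : R).
    have [||x [/= Bx [q _ qx]]] := @dense_rat R (ball (v 0 j) k.+1%:R^-1).
    - by exists (v 0 j); exact: ballxx.
    - exact: ball_open.
    - by exists q; rewrite qx.
  pose q : 'rV[rat]_d.+1 := \row_j sval (cid (Q j)).
  have vq : ball v k.+1%:R^-1 (map_mx ratr q : 'rV[R]_d.+1).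
    by split=> // i j; rewrite ord1 !mxE; case: cid.
  exists (q, k) => /=; last exact: ball_sym.
  move=> w Fw; apply: veU; rewrite [e]splitr.
  by apply: ball_triangle; [apply: le_ball vq|apply: le_ball Fw]; exact: ltW.
rewrite preimage_bigcup bigcup_mkcond.
apply: countable_bigcupT_measurable => [|[q k]]; first exact: countableP.
case: ifPn => _ //.
pose c := @unconsr d (map_mx ratr q : 'rV[R]_d.+1).
have -> : @consr d @^-1` F (q, k) = ball c.1 k.+1%:R^-1 `*` ball c.2 k.+1%:R^-1.
  have k0 : (0 : R) < k.+1%:R^-1 by rewrite invr_gt0.
  apply/seteqP; split=> [[x w] /= [_ B]|[x w] /= [Bx [_ Bw]]].
    split; first by move: (B 0 ord0); rewrite consr0.
    by split=> // i j; have := B 0 (lift ord0 j); rewrite consrS ord1 [c.2 _ _]mxE.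
  split=> // i j; rewrite ord1; case: (unliftP ord0 j) => [l|] ->.
    by rewrite consrS; have := Bw 0 l; rewrite [c.2 _ _]mxE.
  by rewrite consr0.
apply: measurableX; first by apply: measurable_realfun.open_measurable; exact: (ball_open (c.1 : R)).
by apply: open_measurable_rV; exact: ball_open.
Qed.

Lemma measurable_unconsr d : measurable_fun setT (@unconsr d).
Proof.
apply/measurable_fun_pairP; split.
  exact: (measurable_coord ord0).
apply: (@measurability _ _ _ _ _ _ (@open 'rV[R]_d)) => //.
move=> _ [U oU <-]; rewrite setTI; apply: open_measurable_rV.
apply: open_comp oU => v _ A /nbhs_ballP[e /= e0 eA].
apply/nbhs_ballP; exists e => //= w [_ vw]; apply: eA; split=> // i j.
by rewrite !mxE; exact: vw.
Qed.

Lemma lebesgue_measure_rVP d :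
  exists mu : {sigma_finite_measure set 'rV[R]_d -> \bar R},
    @lebesgue_measure_rV d = mu.
Proof.
elim: d => [|d [mu muE]].
  by exists (\d_(0 : 'rV[R]_0)).
pose nu := pushforward (lebesgue_measure \x mu)%E (@consr d).
have mc := @measurable_consr d.
have nu0 : nu set0 = 0%E by rewrite /nu; apply: measure0.
have nu_ge0 A : (0 <= nu A)%E by rewrite /nu; apply: measure_ge0.
have nu_sigma : semi_sigma_additive nu.
  by rewrite /nu; apply: measure_semi_sigma_additive.
have sf : sigma_finite setT nu.
  have [F FT Foo] := product_sigma_finite lebesgue_measure mu.
  exists (fun n => @unconsr d @^-1` F n) => [|n].
    by rewrite -preimage_bigcup -FT preimage_setT.
  have [mF Fn] := Foo n.
  split; first by rewrite -[X in measurable X]setTI; exact: measurable_unconsr.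
  rewrite /nu /pushforward -comp_preimage (_ : _ \o _ = id)//.
  by apply/funext => p /=; rewrite consrK.
by rewrite /= muE; exact: sigma_finite_measureP.
Qed.

Lemma lebesgue_measure_rV0 d : @lebesgue_measure_rV d set0 = 0%E.
Proof. by have [mu ->] := lebesgue_measure_rVP d. Qed.

Lemma lebesgue_measure_rV_ge0 d (A : set 'rV[R]_d) :
  (0 <= lebesgue_measure_rV A)%E.
Proof. by have [mu ->] := lebesgue_measure_rVP d. Qed.

Lemma lebesgue_measure_rV_semi_sigma_additive d :
  semi_sigma_additive (@lebesgue_measure_rV d).
Proof.
have [mu ->] := lebesgue_measure_rVP d; exact: measure_semi_sigma_additive.
Qed.

HB.instance Definition _ d := isMeasure.Build _ _ _ (@lebesgue_measure_rV d)
  (@lebesgue_measure_rV0 d) (@lebesgue_measure_rV_ge0 d)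
  (@lebesgue_measure_rV_semi_sigma_additive d).

Lemma lebesgue_measure_rV_sigma_finite d :
  sigma_finite setT (@lebesgue_measure_rV d).
Proof. by have [mu ->] := lebesgue_measure_rVP d; exact: sigma_finiteT. Qed.

HB.instance Definition _ d := @Measure_isSigmaFinite.Build _ _ _
  (@lebesgue_measure_rV d) (@lebesgue_measure_rV_sigma_finite d).

Lemma lebesgue_measure_rV_box d (A : 'I_d -> set (measurableTypeR R)) :
  (forall i, measurable (A i)) ->
  lebesgue_measure_rV [set v : 'rV[R]_d | forall i, A i (v 0 i)] =
  (\prod_(i < d) lebesgue_measure (A i))%E.
Proof.
elim: d => [|d IH] in A *; move=> mA.
  rewrite big_ord0 /= diracE mem_set//= => -[].
  by case.
rewrite big_ord_recl -IH//= /pushforward.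
have [mu muE] := lebesgue_measure_rVP d.
rewrite muE -product_measure1E//.
  congr (product_measure1 _ _ _); apply/seteqP; split=> [p /= Ap|p /= [A0 AS] i].
    by split=> [|i]; [have := Ap ord0; rewrite consr0|
                      have := Ap (lift ord0 i); rewrite consrS].
  by case: (unliftP ord0 i) => [j|] ->; rewrite ?consr0 ?consrS.
pose B := \bigcap_(i in [set: 'I_d])
  [set v : 'rV[R]_d | A (lift ord0 i) (v 0 i)].
rewrite (_ : [set _ | _] = B); last first.
  by apply/seteqP; split=> v /= Av i => [_|]; exact: Av.
apply: fin_bigcap_measurable => // i _.
rewrite -[X in measurable X]setTI; exact: measurable_coord.
Qed.

End lebesgue_measure_rV.

Section quantization.
Context {R : realType} {d : nat}.
Implicit Types (N : 'rV[R]_d -> R) (P : probability 'rV[R]_d R) (r : R).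
Implicit Types (A : {fset 'rV[R]_d}) (a x : 'rV[R]_d).

Record is_norm N : Prop := IsNorm {
  is_norm_triangle : forall x y, N (x + y) <= N x + N y ;
  is_norm_homogeneous : forall (k : R) x, N (k *: x) = `|k| * N x ;
  is_norm_eq0 : forall x, N x = 0 -> x = 0 }.

Definition norm_ball N x (s : R) : set 'rV[R]_d := [set y | N (y - x) < s].

(* Extended-real valued, so that the distance to the empty set is +oo. *)
Definition dist_to N x (B : set 'rV[R]_d) : \bar R :=
  ereal_inf [set (N (x - a))%:E | a in B].

Definition msupport P : set 'rV[R]_d :=
  [set x | forall U, open_nbhs x U -> (0 < P U)%E].

Definition peakless N P : Prop :=
  exists c s0 : R, [/\ 0 < c, 0 < s0 &
    forall s, 0 < s < s0 -> forall x, msupport P x ->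
      (c%:E * lebesgue_measure_rV (norm_ball N x s) <= P (norm_ball N x s))%E].

Definition distortion N P r A : \bar R :=
  (\int[P]_x (dist_to N x [set` A] `^ r))%E.

(* This is the r-th power of the quantization error. *)
Definition quantization_error_pow N P r (n : nat) : \bar R :=
  ereal_inf [set distortion N P r A | A in
    [set A : {fset 'rV[R]_d} | (1 <= #|` A| <= n)%N]].

Definition optimal_codebook N P r (n : nat) A : Prop :=
  (#|` A| <= n)%N /\ distortion N P r A = quantization_error_pow N P r n.

Definition voronoi N A a : set 'rV[R]_d :=
  [set x | (N (x - a))%:E = dist_to N x [set` A]].

Definition open_voronoi N A a : set 'rV[R]_d :=
  [set x | ((N (x - a))%:E < dist_to N x ([set` A] `\ a))%E].

(* The inradius of a cell which is the whole space is +oo. *)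
Definition inradius N A a : \bar R :=
  ereal_sup [set s%:E | s in
    [set s : R | 0 < s /\ norm_ball N a s `<=` voronoi N A a]].

Definition circumradius N P A a : \bar R :=
  ereal_inf [set s%:E | s in
    [set s : R | 0 < s /\ voronoi N A a `&` msupport P `<=` norm_ball N a s]].

Definition min_over A (F : 'rV[R]_d -> \bar R) : \bar R :=
  \big[Order.min/+oo%E]_(a <- A) F a.

Definition max_over A (F : 'rV[R]_d -> \bar R) : \bar R :=
  \big[Order.max/-oo%E]_(a <- A) F a.

End quantization.

(* Sequences are indexed by n >= 1; the quotient is the one of \bar R, in which
   a nonnegative x satisfies x / +oo = 0, and x / 0 = +oo if x is nonzero. *)
Definition preceq {R : realType} (a b : nat -> \bar R) : Prop :=
  exists C : R, forall n, (0 < n)%N -> (a n / b n <= C%:E)%E.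

(* Main.v *)
Require Import Defs.
From HB Require Import structures.
From mathcomp Require Import all_boot all_order all_algebra finmap.
From mathcomp Require Import all_classical all_reals all_analysis.
From mathcomp Require Import measurable_realfun ess_sup_inf.
From mathcomp Require Import ring lra zify.

Set Implicit Arguments.
Unset Strict Implicit.
Unset Printing Implicit Defensive.

Import Order.TTheory GRing.Theory Num.Theory.
Import numFieldNormedType.Exports.

Local Open Scope classical_set_scope.
Local Open Scope ring_scope.

(** The argument compares optimal codebooks of consecutive sizes. Write [K] for
    the support of [P], [e n] for the [r]-th power of the quantization error,
    [h n = n ^ (- 1 / d)] and [D n x] for the distance from [x] to [alpha n]; note
    [h n ^ d = 1 / n]. The bounded density gives [P (B (a, s)) <= M s ^ d], and
    peaklessness gives [P (B (x, s)) >= c s ^ d] for [x] in [K] and small [s].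

    The error itself is of order [h n ^ r]: a grid with at most [n] cells gives
    the upper bound ([err_le_scale]), and [n] balls of radius [t h n] cannot
    cover half of the mass, which gives the lower bound ([err_ge]).

    The key is that [e (n - 1) - e n] is of order [h n ^ r / n]. On the one hand,
    adding a point [x] of [K] to [alpha n] improves the codebook on a ball around
    [x] of radius proportional to [D n x], so [e n - e (n + 1)] is at least of
    order [D n x ^ (r + d)] ([err_drop_ge]); as some [x] in [K] has [D n x] at
    least of order [h n], the lower bound follows ([err_drop_scale_ge]). On the
    other hand, by pigeonhole half of the points of [alpha n] have a neighbour
    within the order of [h n]; removing the one whose cell matters least costs at
    most the order of [h n ^ r / n] ([err_drop_scale_le]).

    Combining these, [D n x <= C h n] on [K] ([cdist_alpha_le]), which bounds the
    circumradii, the masses and the losses of the cells from above. For the lower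
    bounds, remove a given point [a] of [alpha n]. If another point were too close
    to [a], the cost would contradict the lower bound for the drop; hence the
    points are separated ([alpha_separated]), which bounds the inradii. As [K] is
    connected, the cell of [a] touches another cell inside [K], so [a] has a
    neighbour within the order of [h n] ([voronoi_neighbour]); then the cost of
    removing [a] is at most of order [h n ^ r] times the mass of its open cell,
    which bounds that mass from below ([mass_open_voronoi_ge]). Since a ball of
    radius [t h n] with [t] small holds at most half of this mass, the loss on
    the open cell is bounded from below too ([loss_open_voronoi_ge]). *)

(** * Norms on row vectors *)

Section norm_theory.
Context {R : realType} {d : nat} (N : 'rV[R]_d -> R) (N_norm : is_norm N).

Lemma is_norm0 : N 0 = 0.
Proof. by rewrite -(scale0r 0) (is_norm_homogeneous N_norm) normr0 mul0r. Qed.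

Lemma is_normN x : N (- x) = N x.
Proof.
by rewrite -scaleN1r (is_norm_homogeneous N_norm) normrN1 mul1r.
Qed.

Lemma is_norm_ge0 x : 0 <= N x.
Proof.
have := is_norm_triangle N_norm x (- x); rewrite subrr is_norm0 is_normN.
by rewrite -mulr2n pmulrn_lge0.
Qed.

Lemma is_norm_distC x y : N (x - y) = N (y - x).
Proof. by rewrite -is_normN opprB. Qed.

Lemma is_norm_distD z x y : N (x - y) <= N (x - z) + N (z - y).
Proof.
by have := is_norm_triangle N_norm (x - z) (z - y); rewrite addrA subrK.
Qed.

Lemma is_norm_distxx x : N (x - x) = 0.
Proof. by rewrite subrr is_norm0. Qed.

Lemma is_norm_dist_gt0 x y : x != y -> 0 < N (x - y).
Proof.
move=> xy; rewrite lt_def is_norm_ge0 andbT; apply: contra xy => /eqP.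
by move/(is_norm_eq0 N_norm) => /eqP; rewrite subr_eq0.
Qed.

Lemma rV_coord_le_norm (x : 'rV[R]_d) i : `|x 0 i| <= `|x|.
Proof.
rewrite [leRHS]mx_normrE; apply/bigmax_geP; right => /=.
by exists (0, i).
Qed.

Lemma is_norm_le_mx_norm : exists2 C, 0 < C & forall x, N x <= C * `|x|.
Proof.
exists (\sum_(i < d) N (delta_mx 0 i) + 1).
  by rewrite ltr_wpDl// sumr_ge0// => i _; exact: is_norm_ge0.
move=> x; rewrite {1}[x]row_sum_delta.
rewrite (@le_trans _ _ (\sum_(i < d) N (x 0 i *: delta_mx 0 i)))//.
  elim/big_ind2 : _ => [|u a v b ua vb|//]; first by rewrite is_norm0.
  by rewrite (le_trans (is_norm_triangle N_norm _ _))// lerD.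
rewrite mulrDl mul1r mulr_suml (@le_trans _ _ (\sum_(i < d)
    N (delta_mx 0 i) * `|x|))// ?lerDl//.
apply: ler_sum => i _; rewrite (is_norm_homogeneous N_norm) mulrC.
by rewrite ler_wpM2l ?is_norm_ge0// rV_coord_le_norm.
Qed.

Lemma is_norm_lipschitz x y : `|N x - N y| <= N (x - y).
Proof.
have tri a b : N a - N b <= N (a - b).
  rewrite lerBlDr; have := is_norm_triangle N_norm (a - b) b.
  by rewrite subrK.
by rewrite ler_norml lerNl opprB {1}is_norm_distC !tri.
Qed.

(** A function that is 1-Lipschitz for [N] is continuous for the product
    topology, since [N] is dominated by the sup norm. *)
Lemma lipschitz_norm_continuous (g : 'rV[R]_d -> R) :
  (forall x y, `|g x - g y| <= N (x - y)) -> continuous g.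
Proof.
move=> gL x; apply/(@cvgrPdist_lt _ _ _ (nbhs x)) => e e0.
have [C C0 NC] := is_norm_le_mx_norm.
have eC : 0 < e / C by rewrite divr_gt0.
apply: filterS (nbhsx_ballx x _ eC) => y.
rewrite mx_norm_ball /ball_/= ltr_pdivlMr// mulrC => xy.
by rewrite (le_lt_trans (gL _ _))// (le_lt_trans (NC _)).
Qed.

Lemma is_norm_continuous : continuous N.
Proof. exact: lipschitz_norm_continuous is_norm_lipschitz. Qed.

Lemma mx_norm_le_is_norm : exists2 c, 0 < c & forall x, c * `|x| <= N x.
Proof.
pose S : set 'rV[R]_d := [set x | `|x| = 1].
have [S0|/set0P S0] := eqVneq S set0.
  exists 1 => // x; rewrite mul1r; have [->|x0] := eqVneq x 0.
    by rewrite normr0 is_norm0.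
  suff : S (`|x|^-1 *: x) by rewrite S0.
  by rewrite /S/= normrZ normfV normr_id mulVf// normr_eq0.
have cS : compact S.
  apply: bounded_closed_compact.
    exists 1; split; first by rewrite num_real.
    by move=> M M1 x /= ->; exact: ltW.
  rewrite (_ : S = (fun x => `|x|) @^-1` [set 1])//.
  apply: closed_comp => [x _|]; first exact: norm_continuous.
  exact: closed_eq.
have [x xS xmin] := EVT_min_rV S0 cS (continuous_subspaceT is_norm_continuous).
have Nx0 : 0 < N x.
  rewrite -[x]subr0; apply: is_norm_dist_gt0; apply/eqP => x0.
  move: xS; rewrite inE /S/= x0 normr0 => /eqP.
  by rewrite eq_sym oner_eq0.
exists (N x) => // y; have [->|y0] := eqVneq y 0.
  by rewrite normr0 mulr0 is_norm_ge0.
rewrite -ler_pdivlMr ?normr_gt0// mulrC.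
rewrite -[X in X * _]ger0_norm ?invr_ge0// -(is_norm_homogeneous N_norm).
by apply: xmin; rewrite inE /S/= normrZ normfV normr_id mulVf// normr_eq0.
Qed.

End norm_theory.

(** * Distance to a codebook and Voronoi cells *)

Section codebook_distance.
Context {R : realType} {d : nat} (N : 'rV[R]_d -> R) (N_norm : is_norm N).
Implicit Types (A : {fset 'rV[R]_d}) (a b x y : 'rV[R]_d).

(** Real-valued distance to a codebook; it is the intended one only for a
    nonempty codebook (for the empty one it is [fine +oo = 0]). *)
Definition cdist A x : R := fine (dist_to N x [set` A]).

Lemma dist_to_nearest A : A != fset0 -> forall x,
  exists2 a, a \in A & dist_to N x [set` A] = (N (x - a))%:E /\
    forall b, b \in A -> N (x - a) <= N (x - b).
Proof.
move=> /fset0Pn[a0 a0A] x.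
case: (Order.TotalTheory.arg_minP (fun a : A => N (x - val a))
  (isT : xpredT [` a0A]%fset)) => a _ amin.
exists (val a); first exact: valP.
have amin' b : b \in A -> N (x - val a) <= N (x - b).
  by move=> bA; exact: (amin [` bA]%fset isT).
split=> //; apply/eqP; rewrite eq_le; apply/andP; split.
  by apply: ereal_inf_lbound; exists (val a) => //=; exact: valP.
by apply: le_ereal_inf_tmp => _ [b /= bA <-]; rewrite lee_fin; exact: amin'.
Qed.

Lemma cdistE A x : A != fset0 -> dist_to N x [set` A] = (cdist A x)%:E.
Proof. by move=> /dist_to_nearest/(_ x)[a _ [Ea _]]; rewrite /cdist Ea. Qed.

Lemma cdist_nearest A : A != fset0 -> forall x,
  exists2 a, a \in A & cdist A x = N (x - a).
Proof.
by move=> A0 x; have [a aA [Ea _]] := dist_to_nearest A0 x;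
  exists a; rewrite // /cdist Ea.
Qed.

Lemma cdist_le A x a : a \in A -> cdist A x <= N (x - a).
Proof.
move=> aA; have A0 : A != fset0 by apply/fset0Pn; exists a.
have [b bA [Eb bmin]] := dist_to_nearest A0 x; rewrite /cdist Eb; exact: bmin.
Qed.

Lemma cdist_ge0 A x : 0 <= cdist A x.
Proof.
have [->|/cdist_nearest/(_ x)[a _ ->]] := eqVneq A fset0; last first.
  exact: is_norm_ge0.
rewrite /cdist (_ : dist_to _ _ _ = +oo%E)// /dist_to.
by rewrite (_ : [set` fset0] = set0) ?image_set0 ?ereal_inf0// -subset0 => z.
Qed.

Lemma cdist_antimono A B x : A != fset0 -> (A `<=` B)%fset ->
  cdist B x <= cdist A x.
Proof.
move=> /cdist_nearest/(_ x)[a aA ->] /fsubsetP AB; exact/cdist_le/AB.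
Qed.

Lemma cdist_lipschitz_le A x y : A != fset0 ->
  cdist A x <= N (x - y) + cdist A y.
Proof.
move=> /cdist_nearest/(_ y)[a aA ->].
exact: le_trans (cdist_le x aA) (is_norm_distD N_norm _ _ _).
Qed.

Lemma cdist_lipschitz A x y : A != fset0 ->
  `|cdist A x - cdist A y| <= N (x - y).
Proof.
move=> A0; rewrite ler_norml lerBlDr cdist_lipschitz_le// andbT.
by rewrite lerNl opprB lerBlDr (is_norm_distC N_norm) cdist_lipschitz_le.
Qed.

Lemma cdist_continuous A : A != fset0 -> continuous (cdist A).
Proof.
by move=> A0; apply: (lipschitz_norm_continuous N_norm) => x y;
  exact: cdist_lipschitz.
Qed.

Lemma dist_norm_continuous a : continuous (fun x => N (x - a)).
Proof.
apply: (lipschitz_norm_continuous N_norm) => x y.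
have -> : x - y = (x - a) - (y - a) by rewrite opprB addrA subrK.
exact: is_norm_lipschitz.
Qed.

Lemma voronoiP A a x : a \in A ->
  voronoi N A a x <-> cdist A x = N (x - a).
Proof.
move=> aA; have A0 : A != fset0 by apply/fset0Pn; exists a.
by rewrite /voronoi/= cdistE//; split => [[]|->].
Qed.

Lemma open_voronoiP A a x :
  open_voronoi N A a x <-> forall b, b \in A -> b != a -> N (x - a) < N (x - b).
Proof.
rewrite /open_voronoi/=.
have -> : [set` A] `\ a = [set` (A `\ a)%fset].
  apply/seteqP; split=> b /=.
    by move=> [bA /eqP ba]; rewrite !inE ba.
  by rewrite !inE => /andP[/eqP].
have [B0|B0] := eqVneq (A `\ a)%fset fset0.
  rewrite B0; split=> [_ b bA ba|_].
    by have : b \in (A `\ a)%fset; [rewrite !inE ba|rewrite B0 inE].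
  rewrite /dist_to (_ : [set` fset0] = set0) ?image_set0 ?ereal_inf0 ?ltry//.
  by rewrite -subset0 => z.
rewrite cdistE// lte_fin; split=> [lt b bA ba|lt].
  by apply: lt_le_trans lt _; apply: cdist_le; rewrite !inE ba.
by have [b] := cdist_nearest B0 x; rewrite !inE => /andP[ba bA] ->; exact: lt.
Qed.

Lemma open_voronoi_sub A a : a \in A -> open_voronoi N A a `<=` voronoi N A a.
Proof.
move=> aA x /open_voronoiP ax; apply/voronoiP => //.
apply/eqP; rewrite eq_le cdist_le//=.
have A0 : A != fset0 by apply/fset0Pn; exists a.
have [b bA ->] := cdist_nearest A0 x.
by have [->//|ba] := eqVneq b a; rewrite ltW// ax.
Qed.

Lemma open_voronoi_trivIset A :
  trivIset [set` A] (open_voronoi N A).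
Proof.
move=> a b /= aA bA [x [/open_voronoiP ax /open_voronoiP bx]].
apply/eqP/negPn/negP => ab.
have ba : b != a by rewrite eq_sym.
by have := lt_trans (ax b bA ba) (bx a aA ab); rewrite ltxx.
Qed.

Lemma voronoi_closed A a : a \in A -> closed (voronoi N A a).
Proof.
move=> aA; have A0 : A != fset0 by apply/fset0Pn; exists a.
rewrite (_ : voronoi N A a = (fun x => cdist A x - N (x - a)) @^-1` [set 0]).
  apply: closed_comp => [x _|]; last exact: closed_eq.
  by apply: continuousB; [exact: cdist_continuous|exact: dist_norm_continuous].
apply/seteqP; split=> x /=.
  by move/(voronoiP x aA) => ->; rewrite subrr.
by move/eqP; rewrite subr_eq0 => /eqP/(voronoiP x aA).
Qed.

Lemma open_voronoi_open A a : open (open_voronoi N A a).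
Proof.
have [B0|B0] := eqVneq (A `\ a)%fset fset0.
  rewrite (_ : open_voronoi _ _ _ = setT); first exact: openT.
  apply/seteqP; split=> // x _; apply/open_voronoiP => b bA ba.
  by have : b \in (A `\ a)%fset; [rewrite !inE ba|rewrite B0 inE].
rewrite (_ : open_voronoi _ _ _ =
    (fun x => cdist (A `\ a)%fset x - N (x - a)) @^-1` [set z | 0 < z]).
  apply: open_comp => [x _|]; last exact: open_gt.
  by apply: continuousB; [exact: cdist_continuous|exact: dist_norm_continuous].
apply/seteqP; split=> x /=; rewrite subr_gt0.
  move/open_voronoiP => H; have [b] := cdist_nearest B0 x.
  by rewrite !inE => /andP[ba bA] ->; exact: H.
move=> H; apply/open_voronoiP => b bA ba.
by apply: lt_le_trans H _; apply: cdist_le; rewrite !inE ba.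
Qed.

(** Only the points of the open cell of [a] are affected by the removal of
    [a] from the codebook. *)
Lemma cdist_remove_out A a x : a \in A -> (A `\ a)%fset != fset0 ->
  ~ open_voronoi N A a x -> cdist (A `\ a)%fset x <= cdist A x.
Proof.
move=> aA B0 nx; have A0 : A != fset0 by apply/fset0Pn; exists a.
have [b] := cdist_nearest A0 x; have [-> _ E|ba bA ->] := eqVneq b a; last first.
  by apply: cdist_le; rewrite !inE ba.
rewrite leNgt; apply/negP => lt; apply: nx; apply/open_voronoiP => c cA ca.
by rewrite -E; apply: lt_le_trans lt _; apply: cdist_le; rewrite !inE ca.
Qed.

(** The points of the cell of [a] can be served by any other point [b]. *)
Lemma cdist_remove_le A a b x : b \in A -> b != a ->
  cdist (A `\ a)%fset x <= N (x - a) + N (a - b).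
Proof.
move=> bA ba; rewrite (le_trans _ (is_norm_distD N_norm _ _ _))//.
by apply: cdist_le; rewrite !inE ba.
Qed.

Lemma cdist_remove_in A a b x : a \in A -> open_voronoi N A a x ->
  b \in A -> b != a -> cdist (A `\ a)%fset x <= cdist A x + N (a - b).
Proof.
move=> aA /(open_voronoi_sub aA)/(voronoiP x aA) ->; exact: cdist_remove_le.
Qed.

Lemma norm_ball_open x s : open (norm_ball N x s).
Proof.
rewrite (_ : norm_ball N x s = (fun y => N (y - x)) @^-1` [set z | z < s])//.
by apply: open_comp => [y _|]; [exact: dist_norm_continuous|exact: open_lt].
Qed.

End codebook_distance.

(** * Mass of balls and of the support *)

Section lebesgue_balls.
Context {R : realType} {d : nat} (N : 'rV[R]_d -> R) (N_norm : is_norm N).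

Lemma lebesgue_measure_rV_cube (a : 'rV[R]_d) (t : R) : 0 <= t ->
  lebesgue_measure_rV
    [set v : 'rV[R]_d | forall i, `[a 0 i - t, a 0 i + t]%classic (v 0 i)] =
  ((t *+ 2) ^+ d)%:E.
Proof.
move=> t0; rewrite (lebesgue_measure_rV_box
  (A := fun i => `[a 0 i - t, a 0 i + t]%classic)); last first.
  by move=> i; exact: measurable_itv.
rewrite (eq_bigr (fun=> (t *+ 2)%:E)) => [|i _].
  by rewrite prodEFin prodr_const card_ord.
rewrite lebesgue_measure_itv/= lte_fin.
by case: ltP => h; rewrite -?EFinB; congr (_%:E); rewrite mulr2n; lra.
Qed.

Lemma measurable_cube (a : 'rV[R]_d) (t : R) : measurable
  [set v : 'rV[R]_d | forall i, `[a 0 i - t, a 0 i + t]%classic (v 0 i)].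
Proof.
pose B := \bigcap_(i in [set: 'I_d])
  [set v : 'rV[R]_d | `[a 0 i - t, a 0 i + t]%classic (v 0 i)].
rewrite (_ : [set _ | _] = B); last first.
  by apply/seteqP; split=> v /= Av i => [_|]; exact: Av.
apply: fin_bigcap_measurable => // i _.
by rewrite -[X in measurable X]setTI; apply: measurable_coord => //.
Qed.

Lemma measurable_norm_ball x s : measurable (norm_ball N x s).
Proof. by apply: open_measurable_rV; exact: norm_ball_open. Qed.

Lemma lebesgue_norm_ball_le : exists2 v : R, 0 < v & forall a s, 0 <= s ->
  (lebesgue_measure_rV (norm_ball N a s) <= (v * s ^+ d)%:E)%E.
Proof.
have [c c0 cN] := mx_norm_le_is_norm N_norm.
exists ((c^-1 *+ 2) ^+ d); first by rewrite exprn_gt0// pmulrn_lgt0// invr_gt0.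
move=> a s s0; have t0 : 0 <= c^-1 * s by rewrite mulr_ge0// invr_ge0 ltW.
rewrite -exprMn mulrnAl -(lebesgue_measure_rV_cube a t0).
apply: le_measure; rewrite ?inE; [exact: measurable_norm_ball|
  exact: measurable_cube|].
move=> v /= vs i; rewrite in_itv/= -ler_distl distrC.
rewrite mulrC ler_pdivlMr// mulrC (le_trans _ (ltW vs))//.
apply: le_trans (cN _); rewrite ler_wpM2l ?(ltW c0)//.
have := rV_coord_le_norm (v - a) i.
by rewrite !mxE distrC.
Qed.

Lemma lebesgue_norm_ball_ge : exists2 v : R, 0 < v & forall a s, 0 < s ->
  ((v * s ^+ d)%:E <= lebesgue_measure_rV (norm_ball N a s))%E.
Proof.
have [C C0 NC] := is_norm_le_mx_norm N_norm.
exists (C^-1 ^+ d); first by rewrite exprn_gt0// invr_gt0.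
move=> a s s0; pose t := C^-1 * s / 2.
have t0 : 0 <= t by rewrite divr_ge0// mulr_ge0 ?invr_ge0 ?ltW.
have -> : C^-1 ^+ d * s ^+ d = (t *+ 2) ^+ d.
  by rewrite -exprMn /t -mulr_natr mulfVK// pnatr_eq0.
rewrite -(lebesgue_measure_rV_cube a t0).
apply: le_measure; rewrite ?inE; [exact: measurable_cube|
  exact: measurable_norm_ball|].
move=> v /= vt; rewrite /norm_ball/= (le_lt_trans (NC _))//.
have : `|v - a| <= t.
  rewrite [leLHS]mx_normrE; apply/bigmax_leP; split=> // -[i j] _ /=.
  by rewrite ord1 !mxE distrC ler_distlC; have := vt j; rewrite in_itv.
move=> /(ler_wpM2l (ltW C0))/le_lt_trans; apply.
rewrite /t mulrA mulrA divff ?gt_eqF// mul1r ltr_pdivrMr// ltr_pMr//.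
by rewrite ltr1n.
Qed.

End lebesgue_balls.

Section probability_facts.
Context {R : realType} {d : nat} (N : 'rV[R]_d -> R) (N_norm : is_norm N).
Context (P : probability 'rV[R]_d R).

(** A bounded density makes [P] upper Ahlfors regular. *)
Lemma bounded_density_ball (f : 'rV[R]_d -> R)
    (f_meas : measurable_fun [set: 'rV[R]_d] f) (f_ge0 : forall x, 0 <= f x)
    (P_density : forall A : set 'rV[R]_d, measurable A ->
      P A = (\int[@lebesgue_measure_rV R d]_(x in A) (f x)%:E)%E)
    (f_bounded : (ess_sup (@lebesgue_measure_rV R d) (EFin \o f) < +oo)%E) :
  exists2 M : R, 0 < M & forall a s, 0 <= s ->
    (P (norm_ball N a s) <= (M * s ^+ d)%:E)%E.
Proof.
have [v v0 ballv] := lebesgue_norm_ball_le N_norm.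
have [m m0 fm] : exists2 m : R, 0 < m &
    \forall x \ae (@lebesgue_measure_rV R d), ((f x)%:E <= m%:E)%E.
  have le_m (m : R) : (ess_sup (@lebesgue_measure_rV R d) (EFin \o f) <= m%:E)%E ->
      \forall x \ae (@lebesgue_measure_rV R d), ((f x)%:E <= m%:E)%E.
    by move=> /ess_supP.
  move: f_bounded; case E : ess_sup => [e| |] // _.
    exists (Num.max e 1); first by rewrite lt_max ltr01 orbT.
    by apply: le_m; rewrite E lee_fin le_max lexx.
  by exists 1 => //; apply: le_m; rewrite E leNye.
exists (m * v); first exact: mulr_gt0.
move=> a s s0; have mB := measurable_norm_ball N_norm a s.
rewrite P_density// (@le_trans _ _
    (\int[@lebesgue_measure_rV R d]_(x in norm_ball N a s) m%:E)%E)//.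
  apply: ae_ge0_le_integral => //.
  - by move=> x _; rewrite lee_fin.
  - by apply/measurable_EFinP; exact: measurable_funTS.
  - by move=> x _; rewrite lee_fin ltW.
  - by apply: filterS fm => x fx _.
rewrite integral_cst// -mulrA EFinM lee_wpmul2l ?lee_fin ?(ltW m0)//.
exact: ballv.
Qed.

Lemma peakless_ball : peakless N P ->
  exists c s0 : R, [/\ 0 < c, 0 < s0 & forall x s, msupport P x ->
    0 < s < s0 -> ((c * s ^+ d)%:E <= P (norm_ball N x s))%E].
Proof.
move=> [c [s0 [c0 s00 Ps]]]; have [v v0 ballv] := lebesgue_norm_ball_ge N_norm.
exists (c * v), s0; split; rewrite ?mulr_gt0// => x s Kx /[dup] /andP[ps _] ss.
apply: le_trans (Ps s ss x Kx); rewrite -mulrA EFinM.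
by rewrite lee_wpmul2l ?lee_fin ?(ltW c0)//; exact: ballv.
Qed.

Lemma open_rat_balls (U : set 'rV[R]_d) v : open U -> U v ->
  exists q : 'rV[rat]_d * nat,
    ball (map_mx ratr q.1 : 'rV[R]_d) (q.2.+1%:R^-1 : R) v /\
    ball (map_mx ratr q.1 : 'rV[R]_d) (q.2.+1%:R^-1 : R) `<=` U.
Proof.
move=> oU Uv.
have /nbhs_ballP[e /= e0 veU] : nbhs v U by exact: open_nbhs_nbhs.
have e20 : 0 < e / 2 by exact: divr_gt0.
have [k ke] : exists k : nat, k.+1%:R^-1 < e / 2.
  exists (Num.truncn (e / 2)^-1); rewrite invf_plt ?posrE//.
  by have := truncnS_gt (e / 2)^-1.
have k0 : (0 : R) < k.+1%:R^-1 by rewrite invr_gt0.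
have Q j : exists q : rat, ball (v 0 j) k.+1%:R^-1 (ratr q : R).
  have [||x [/= Bx [q _ qx]]] := @dense_rat R (ball (v 0 j) k.+1%:R^-1).
  - by exists (v 0 j); exact: ballxx.
  - exact: ball_open.
  - by exists q; rewrite qx.
pose q : 'rV[rat]_d := \row_j sval (cid (Q j)).
have vq : ball v k.+1%:R^-1 (map_mx ratr q : 'rV[R]_d).
  by split=> // i j; rewrite ord1 !mxE; case: cid.
exists (q, k); split=> /=; first exact: ball_sym.
move=> w Fw; apply: veU; rewrite [e]splitr.
by apply: ball_triangle; [apply: le_ball vq|apply: le_ball Fw]; exact: ltW.
Qed.

Lemma msupport_closed : closed (msupport P).
Proof.
rewrite -[msupport P]setCK; apply: open_closedC.
rewrite openE => x /= /existsNP[U /not_implyP[[oU Ux] PU]].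
apply: (@filterS _ _ _ U); last exact: open_nbhs_nbhs.
by move=> y Uy /(_ U (conj oU Uy)).
Qed.

(** The support has full measure because the space has a countable base: its
    complement is covered by countably many negligible balls. *)
Lemma msupport_full : P (~` msupport P) = 0%E.
Proof.
pose F (q : 'rV[rat]_d * nat) : set 'rV[R]_d :=
  ball (map_mx ratr q.1 : 'rV[R]_d) (q.2.+1%:R^-1 : R).
have mF q : measurable (F q).
  apply: open_measurable_rV; apply: ball_open; by rewrite invr_gt0.
pose G q := if P (F q) == 0%E then F q else set0.
have mG q : measurable (G q) by rewrite /G; case: ifP.
have G0 q : P (G q) = 0%E by rewrite /G; case: ifP => [/eqP//|_]; rewrite measure0.
have sub : ~` msupport P `<=` \bigcup_q G q.
  move=> x /existsNP[U /not_implyP[[oU Ux] PU]].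
  have [q [xq qU]] := open_rat_balls oU Ux.
  exists q => //; rewrite /G ifT//; apply/eqP/le_anti/andP; split=> //.
  apply: le_trans (_ : P U <= 0)%E; last by rewrite leNgt; exact/negP.
  by apply: le_measure; rewrite ?inE//; exact: open_measurable_rV.
have mC : measurable (~` msupport P).
  apply: open_measurable_rV; apply/closed_openC; exact: msupport_closed.
have [g gE] : exists g : nat -> 'rV[rat]_d * nat, forall q, exists n, g n = q.
  exists (fun n => odflt (0, 0%N) (@choice.unpickle _ n)) => q.
  by exists (choice.pickle q); rewrite choice.pickleK.
apply: measure_negligible => //.
apply: (@negligibleS _ _ _ P (\bigcup_n G (g n))).
  by apply: subset_trans sub _ => x [q _ Gx]; have [n gn] := gE q;
    exists n => //; rewrite gn.
apply: negligible_bigcup => n; apply/negligibleP; [exact: mG|exact: G0].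
Qed.

End probability_facts.

(** * Integral inequalities for almost sure comparisons *)

Section almost_sure_bounds.
Context {disp} {T : measurableType disp} {R : realType}.
Context (P : probability T R) (K : set T) (aeK : \forall x \ae P, K x).
Implicit Types (g h G : T -> R) (B D : set T).

Lemma ge0_integral_le_addset g h G B :
  measurable_fun setT g -> measurable_fun setT h -> measurable_fun setT G ->
  (forall x, 0 <= g x) -> (forall x, 0 <= h x) -> (forall x, 0 <= G x) ->
  measurable B ->
  (forall x, K x -> B x -> g x <= h x + G x) ->
  (forall x, K x -> ~ B x -> g x <= h x) ->
  (\int[P]_x (g x)%:E <= \int[P]_x (h x)%:E + \int[P]_(x in B) (G x)%:E)%E.
Proof.
move=> mg mh mG g0 h0 G0 mB gB gNB.
rewrite [X in (_ + X)%E]integral_mkcond -ge0_integralD//; first last.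
- by apply/(measurable_restrictT _ _).1 => //;
    apply/measurable_EFinP; exact: measurable_funTS.
- by move=> x _; apply: erestrict_ge0 => y _; rewrite lee_fin.
- exact/measurable_EFinP.
- by move=> x _; rewrite lee_fin.
apply: ae_ge0_le_integral => //.
- by move=> x _; rewrite lee_fin.
- exact/measurable_EFinP.
- move=> x _; apply: adde_ge0; first by rewrite lee_fin.
  by apply: erestrict_ge0 => y _; rewrite lee_fin.
- apply: emeasurable_funD; first exact/measurable_EFinP.
  by apply/(measurable_restrictT _ _).1 => //;
    apply/measurable_EFinP; exact: measurable_funTS.
- apply: filterS aeK => x Kx _; rewrite patchE; case: ifPn => xB.
    by rewrite -EFinD lee_fin gB//; exact: set_mem.
  by rewrite adde0 lee_fin gNB//; move: xB; rewrite notin_setE.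
Qed.

Lemma ge0_integral_le_add g h w B :
  measurable_fun setT g -> measurable_fun setT h ->
  (forall x, 0 <= g x) -> (forall x, 0 <= h x) -> 0 <= w ->
  measurable B ->
  (forall x, K x -> B x -> g x <= h x + w) ->
  (forall x, K x -> ~ B x -> g x <= h x) ->
  (\int[P]_x (g x)%:E <= \int[P]_x (h x)%:E + w%:E * P B)%E.
Proof.
move=> mg mh g0 h0 w0 mB gB gNB.
by rewrite -integral_cst//; apply: (@ge0_integral_le_addset g h (cst w)).
Qed.

Lemma ge0_integral_add_le g h w B :
  measurable_fun setT g -> measurable_fun setT h ->
  (forall x, 0 <= g x) -> (forall x, 0 <= h x) -> 0 <= w ->
  measurable B ->
  (forall x, K x -> B x -> g x + w <= h x) ->
  (forall x, K x -> ~ B x -> g x <= h x) ->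
  (\int[P]_x (g x)%:E + w%:E * P B <= \int[P]_x (h x)%:E)%E.
Proof.
move=> mg mh g0 h0 w0 mB gB gNB.
rewrite -integral_cst// [X in (_ + X)%E]integral_mkcond -ge0_integralD//; first last.
- by apply/(measurable_restrictT _ _).1.
- by move=> x _; apply: erestrict_ge0 => y _; rewrite lee_fin.
- exact/measurable_EFinP.
- by move=> x _; rewrite lee_fin.
apply: ae_ge0_le_integral => //.
- move=> x _; apply: adde_ge0; first by rewrite lee_fin.
  by apply: erestrict_ge0 => y _; rewrite lee_fin.
- apply: emeasurable_funD; first exact/measurable_EFinP.
  by apply/(measurable_restrictT _ _).1.
- by move=> x _; rewrite lee_fin.
- exact/measurable_EFinP.
- apply: filterS aeK => x Kx _; rewrite patchE; case: ifPn => xB.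
    by rewrite /cst -EFinD lee_fin gB//; exact: set_mem.
  by rewrite adde0 lee_fin gNB//; move: xB; rewrite notin_setE.
Qed.

Lemma ge0_integral_set_le g w D : measurable_fun setT g ->
  (forall x, 0 <= g x) -> 0 <= w -> measurable D ->
  (forall x, K x -> D x -> g x <= w) ->
  (\int[P]_(x in D) (g x)%:E <= w%:E * P D)%E.
Proof.
move=> mg g0 w0 mD gw; rewrite -integral_cst//.
apply: ae_ge0_le_integral => //.
- by move=> x _; rewrite lee_fin.
- by apply/measurable_EFinP; exact: measurable_funTS.
- by apply: filterS aeK => x Kx Dx; rewrite lee_fin gw.
Qed.

Lemma ge0_integral_set_ge g w B D : measurable_fun setT g ->
  (forall x, 0 <= g x) -> 0 <= w -> measurable B -> measurable D ->
  B `<=` D -> (forall x, K x -> B x -> w <= g x) ->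
  (w%:E * P B <= \int[P]_(x in D) (g x)%:E)%E.
Proof.
move=> mg g0 w0 mB mD BD wg; rewrite -integral_cst//.
apply: (@le_trans _ _ (\int[P]_(x in B) (g x)%:E)%E).
  apply: ae_ge0_le_integral => //.
  - by move=> x _; rewrite lee_fin.
  - by apply/measurable_EFinP; exact: measurable_funTS.
  - by apply: filterS aeK => x Kx Bx; rewrite lee_fin wg.
apply: ge0_subset_integral => //.
- by apply/measurable_EFinP; exact: measurable_funTS.
- by move=> x _; rewrite lee_fin.
Qed.

End almost_sure_bounds.

(** If the integrals of [G] over finitely many disjoint sets are all at least
    [t], then [G] has integral at least [t] times their number. *)
Lemma ge0_integral_disjoint_ge {disp} {T : measurableType disp} {R : realType}
    (P : probability T R) (I : choiceType) (S : {fset I}) (F : I -> set T)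
    (G : T -> R) (t : R) :
  measurable_fun setT G -> (forall x, 0 <= G x) ->
  (forall i, measurable (F i)) -> trivIset [set` S] F ->
  (forall i, i \in S -> (t%:E <= \int[P]_(x in F i) (G x)%:E)%E) ->
  ((#|` S|%:R * t)%:E <= \int[P]_x (G x)%:E)%E.
Proof.
move=> mG G0 mF tF tS.
apply: (@le_trans _ _
    (\int[P]_(x in \big[setU/set0]_(i <- S) F i) (G x)%:E)%E); last first.
  apply: ge0_subset_integral => //.
  - exact: bigsetU_measurable.
  - exact/measurable_EFinP.
  - by move=> x _; rewrite lee_fin.
rewrite ge0_integral_bigsetU//.
- have -> : (#|` S|%:R * t)%:E = (\sum_(i <- S) t%:E)%E.
    by rewrite sumEFin big_const_seq count_predT iter_addr addr0 mulr_natl.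
  by rewrite [leLHS]big_seq [leRHS]big_seq; apply: lee_sum.
- by apply/measurable_EFinP; exact: measurable_funTS.
- by move=> x _; rewrite lee_fin.
Qed.

(** * Grids, pigeonhole and powers *)

Section grid.
Context {R : realType} {d : nat} (N : 'rV[R]_d -> R) (N_norm : is_norm N).

Lemma norm_ball_grid (k0 : 'rV[R]_d) (L : R) : 0 < L ->
  exists2 C : R, 0 < C & forall q : nat, (0 < q)%N ->
  exists cell : 'rV[R]_d -> {ffun 'I_d -> 'I_q}, forall x y,
    N (x - k0) <= L -> N (y - k0) <= L -> cell x = cell y ->
    N (x - y) <= C / q%:R.
Proof.
move=> L0; have [c c0 cN] := mx_norm_le_is_norm N_norm.
have [C C0 NC] := is_norm_le_mx_norm N_norm.
pose L' := L / c + 1; have L'0 : 0 < L' by rewrite ltr_wpDl// divr_ge0 ?ltW.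
exists (C * (L' *+ 2)); first by rewrite mulr_gt0// pmulrn_lgt0.
move=> [//|p] _; set q := p.+1.
have q0 : 0 < q%:R :> R by rewrite ltr0n.
pose t (x : 'rV[R]_d) i := (x 0 i - k0 0 i + L') / (L' *+ 2) * q%:R.
have L'20 : 0 < L' *+ 2 by rewrite pmulrn_lgt0.
have tq x i : N (x - k0) <= L -> 0 <= t x i < q%:R.
  move=> xL; have : `|x 0 i - k0 0 i| < L'.
    apply: (@le_lt_trans _ _ (L / c)); last by rewrite ltrDl.
    rewrite ler_pdivlMr// mulrC (le_trans _ xL)// (le_trans _ (cN _))//.
    rewrite ler_wpM2l ?(ltW c0)//; have := rV_coord_le_norm (x - k0) i.
    by rewrite !mxE.
  rewrite ltr_norml => /andP[lo hi]; apply/andP; split.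
    by rewrite /t mulr_ge0// divr_ge0// ?(ltW L'20)// -lerBlDr sub0r ltW.
  by rewrite /t gtr_pMl// ltr_pdivrMr// mul1r mulr2n ltrD2r.
exists (fun x => [ffun i => inord (Num.truncn (t x i))]) => x y xL yL /ffunP xy.
rewrite (le_trans (NC _))// -mulrA ler_wpM2l ?(ltW C0)//.
rewrite [leLHS]mx_normrE; apply/bigmax_leP; split=> [|[j i] _ /=].
  by rewrite divr_ge0// ltW.
rewrite ord1 !mxE; have := xy i; rewrite !ffunE => /(congr1 (@nat_of_ord _)).
have /andP[tx0 txq] := tq _ i xL; have /andP[ty0 tyq] := tq _ i yL.
rewrite !inordK ?truncn_lt_nat//.
move=> e; have /andP[x1 x2] := truncn_itv tx0; have /andP[y1 y2] := truncn_itv ty0.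
have txy : `|t x i - t y i| <= 1.
  rewrite e in x1 x2; rewrite ler_norml; move: x1 x2 y1 y2.
  by rewrite -natr1 => *; apply/andP; split; lra.
have -> : x 0 i - y 0 i = (t x i - t y i) * (L' *+ 2 / q%:R).
  by rewrite /t; field; rewrite !gt_eqF.
by rewrite normrM [X in _ * X]gtr0_norm ?divr_gt0// ler_piMl// ltW// divr_gt0.
Qed.

End grid.

Lemma nat_root (d M : nat) : (0 < d)%N -> (0 < M)%N ->
  exists q : nat, [/\ (0 < q)%N, (q ^ d <= M)%N & (M < q.+1 ^ d)%N].
Proof.
move=> d0 M0.
have ex : exists q, (q ^ d <= M)%N by exists 1%N; rewrite exp1n.
have ub q : (q ^ d <= M)%N -> (q <= M)%N.
  by apply: leq_trans; case: (q) => // p; rewrite -{1}(expn1 p.+1) leq_pexp2l.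
case: (ex_maxnP ex ub) => q qM qmax; exists q; split=> //.
  by rewrite (leq_trans _ (qmax 1%N _))// exp1n.
by rewrite ltnNge; apply/negP => /qmax; rewrite ltnn.
Qed.

(** Pigeonhole: if a set has at least twice as many points as there are
    cells, then at least half of its points share their cell with another
    one. *)
Lemma pigeonhole_half (T : choiceType) (F : finType) (cell : T -> F)
    (A : {fset T}) : (2 * #|F| <= #|` A|)%N ->
  exists S : {fset T}, [/\ (S `<=` A)%fset, (#|` A| <= 2 * #|` S|)%N &
    forall a, a \in S -> exists2 b, b \in A & b != a /\ cell b = cell a].
Proof.
move=> FA.
pose S := [fset a in A | `[< exists2 b, b \in A & b != a /\ cell b = cell a >]]%fset.
exists S; split.
- by apply/fsubsetP => a; rewrite !inE => /andP[].
- have AS : (#|` (A `\` S)%fset| <= #|F|)%N.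
    have U : uniq (map cell (A `\` S)%fset).
      rewrite map_inj_in_uniq ?fset_uniq// => a b.
      rewrite !inE => /andP[/nandP[/negP//|/asboolPn na] aA] /andP[_ bA] ab.
      apply/eqP/negPn/negP => nab; apply: na; exists b => //.
      by rewrite eq_sym.
    rewrite -(size_map cell) -(card_uniqP U); exact: max_card.
  have SA : (S `<=` A)%fset by apply/fsubsetP => a; rewrite !inE => /andP[].
  have := cardfsDS SA; have := fsubset_leq_card SA; lia.
- by move=> a; rewrite !inE => /andP[_ /asboolP].
Qed.

Section scale.
Context {R : realType} (d : nat) (d_gt0 : (0 < d)%N).

(** The natural length scale [n ^ (-1/d)] of a codebook with [n] points. *)
Definition scale n : R := n%:R `^ (- d%:R^-1).

Lemma scale_gt0 n : (0 < n)%N -> 0 < scale n.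
Proof. by move=> n0; rewrite powR_gt0// ltr0n. Qed.

Lemma scaleX n : scale n ^+ d = n%:R^-1.
Proof.
rewrite -powR_mulrn ?powR_ge0// -powRrM mulNr mulVf ?pnatr_eq0 -?lt0n//.
by rewrite powR_inv1.
Qed.

Lemma scale1 : scale 1 = 1.
Proof. by rewrite /scale powR1. Qed.

Lemma le_scale m n : (0 < m)%N -> (m <= n)%N -> scale n <= scale m.
Proof.
move=> m0 mn; have n0 := leq_trans m0 mn.
rewrite -(@ler_pXn2r _ d) ?nnegrE ?powR_ge0// !scaleX.
by rewrite lef_pV2 ?posrE ?ltr0n// ler_nat.
Qed.

(** A cubic grid with at most [n / 2] cells and mesh of order [scale n]. *)
Lemma grid_size n : (2 <= n)%N ->
  exists q : nat, [/\ (0 < q)%N, (2 * q ^ d <= n)%N & q%:R^-1 <= 4 * scale n].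
Proof.
move=> n2; have [|q [q0 qn nq]] := @nat_root d n./2 d_gt0.
  by case: n n2 => [|[|]].
have n0 : (0 < n)%N by apply: leq_trans n2.
exists q; split=> //; first lia.
have qR : 0 < q%:R :> R by rewrite ltr0n.
rewrite leNgt; apply/negP => lt.
have : q.+1%:R * scale n < 2^-1.
  apply: (@le_lt_trans _ _ (2 * q%:R * scale n)).
    rewrite ler_wpM2r ?powR_ge0// -natrM ler_nat; lia.
  move: lt; rewrite -(ltr_pM2l qR) mulfV ?gt_eqF// => lt.
  have -> : 2 * q%:R * scale n = (q%:R * (4 * scale n)) / 2.
    by field.
  by rewrite ltr_pdivrMr// mulVf ?pnatr_eq0//.
move=> /ltW/(lerXn2r d); rewrite !nnegrE mulr_ge0 ?powR_ge0// => /(_ isT).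
rewrite invr_ge0 ler0n => /(_ isT); apply/negP; rewrite -ltNge exprMn scaleX.
apply: (@le_lt_trans _ _ 2^-1).
  by case: d d_gt0 => // k _; rewrite exprS ler_piMr// exprn_ile1// invf_le1 ?ler1n.
rewrite ltr_pdivlMr ?ltr0n// mulrC ltr_pdivrMr// -natrX -natrM ltr_nat.
move: nq; lia.
Qed.

End scale.

(** Uniform continuity of [x |-> x ^ r] on bounded sets of nonnegative reals. *)
Lemma powR_uniform_continuous {R : realType} (r C eta : R) :
  0 < r -> 0 < C -> 0 < eta ->
  exists2 eps : R, 0 < eps & forall u v, 0 <= u <= C -> 0 <= v <= eps ->
    (u + v) `^ r <= u `^ r + eta.
Proof.
move=> r0 C0 eta0.
(* If [u] and [v] are at most [tau], then [(u + v) ^ r] is at most [eta]. *)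
pose tau := eta `^ r^-1 / 2.
have tau0 : 0 < tau by rewrite divr_gt0// powR_gt0.
have tau_r : (tau + tau) `^ r = eta.
  rewrite /tau -splitr -powRrM mulVf ?gt_eqF// powRr1//; exact: ltW.
(* If [tau < u], factor out [u] and bound [(1 + v / u) ^ r] by its power with
   natural exponent [k], which is at most [1 + (v / u) 2 ^ k]. *)
pose k := (Num.truncn r).+1.
have rk : r <= k%:R by rewrite ltW// truncnS_gt.
have bern m (z : R) : 0 <= z <= 1 -> (1 + z) ^+ m <= 1 + z * (2 ^+ m - 1).
  move=> /andP[z0 z1]; elim: m => [|m IH].
    by rewrite !expr0 subrr mulr0 addr0.
  have p1 : 1 <= 2 ^+ m :> R by rewrite exprn_ege1// ler1n.
  rewrite exprS (le_trans (ler_wpM2l _ IH)) ?addr_ge0//.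
  rewrite exprS -subr_ge0.
  have -> : 1 + z * (2 * 2 ^+ m - 1) - (1 + z) * (1 + z * (2 ^+ m - 1)) =
    z * (1 - z) * (2 ^+ m - 1) by ring.
  by rewrite !mulr_ge0 ?subr_ge0.
pose Q := C `^ r * 2 ^+ k.
have Q0 : 0 < Q by rewrite mulr_gt0 ?powR_gt0// exprn_gt0.
exists (Num.min tau (tau * eta / Q)).
  by rewrite lt_min tau0/= divr_gt0// mulr_gt0.
move=> u v /andP[u0 uC] /andP[v0]; rewrite le_min => /andP[vtau vQ].
have [utau|tauu] := leP u tau.
  rewrite (@le_trans _ _ eta) ?lerDr ?powR_ge0// -tau_r.
  apply: ge0_ler_powR; rewrite ?nnegrE ?(ltW r0) ?addr_ge0 ?(ltW tau0)//.
  exact: lerD.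
have u_gt0 : 0 < u by exact: lt_trans tauu.
have z01 : 0 <= v / u <= 1.
  by rewrite divr_ge0//= ler_pdivrMr// mul1r (le_trans vtau)// ltW.
have zge1 : 1 <= 1 + v / u by rewrite lerDl; case/andP: z01.
have -> : u + v = u * (1 + v / u) by field; rewrite gt_eqF.
rewrite powRM//; last by rewrite (le_trans _ zge1).
have h1 : (1 + v / u) `^ r <= 1 + v / u * 2 ^+ k.
  rewrite (@le_trans _ _ ((1 + v / u) ^+ k))//.
    rewrite -powR_mulrn ?(le_trans _ zge1)//; exact: ler_powR.
  by rewrite (le_trans (bern k _ z01))// lerD2l ler_wpM2l ?gerBl//; case/andP: z01.
rewrite (le_trans (ler_wpM2l (powR_ge0 _ _) h1))// mulrDr mulr1 lerD2l.
apply: (@le_trans _ _ (C `^ r * (v / tau * 2 ^+ k))).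
  apply: ler_pM; rewrite ?powR_ge0//.
  - by rewrite mulr_ge0 ?exprn_ge0// divr_ge0.
  - by apply: ge0_ler_powR; rewrite ?nnegrE// ltW.
  rewrite ler_pM2r ?exprn_gt0// ler_wpM2l// lef_pV2 ?posrE//; exact: ltW.
have -> : C `^ r * (v / tau * 2 ^+ k) = v * Q / tau.
  by rewrite /Q; field; rewrite gt_eqF.
by rewrite ler_pdivrMr// -ler_pdivlMr// [eta * tau]mulrC.
Qed.

(** * The quantization error *)

Lemma continuous_measurable_rV {R : realType} d (g : 'rV[R]_d -> R) :
  continuous g -> measurable_fun setT (g : 'rV[R]_d -> measurableTypeR R).
Proof.
move=> cg; apply: (measurability _ (RGenOpens.measurableE R)).
move=> _ [_ [a [b ->] <-]]; rewrite setTI; apply: open_measurable_rV.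
by apply: open_comp; [move=> v _; exact: cg|exact: interval_open].
Qed.

Lemma ler_powR_base {R : realType} (r x y : R) : 0 <= r -> 0 <= x -> x <= y ->
  x `^ r <= y `^ r.
Proof.
move=> r0 x0 xy; apply: ge0_ler_powR; rewrite ?nnegrE//.
exact: le_trans xy.
Qed.

Lemma ltr_powR_base {R : realType} (r x y : R) : 0 < r -> 0 <= x -> x < y ->
  x `^ r < y `^ r.
Proof.
move=> r0 x0 xy; apply: gt0_ltr_powR; rewrite ?nnegrE//.
exact: le_trans (ltW xy).
Qed.

Lemma probability_le_ae {disp} {T : measurableType disp} {R : realType}
    (P : probability T R) (K A B : set T) : measurable A -> measurable B ->
  (\forall x \ae P, K x) -> (forall x, K x -> A x -> B x) -> (P A <= P B)%E.
Proof.
move=> mA mB [Z [mZ PZ KZ]] AB.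
apply: (@le_trans _ _ (P (B `|` Z))).
  apply: le_measure; rewrite ?inE//; first exact: measurableU.
  move=> x Ax; have [Kx|nK] := pselect (K x); first by left; exact: AB.
  by right; exact: KZ.
by rewrite -[leRHS]adde0 -PZ; exact: measureU2.
Qed.

Section quantization_error.
Context {R : realType} {d : nat} (N : 'rV[R]_d -> R) (N_norm : is_norm N).
Context (r : R) (r_gt0 : 0 < r) (P : probability 'rV[R]_d R).
Implicit Types (A B : {fset 'rV[R]_d}).

Lemma measurable_cdist_powR A : A != fset0 ->
  measurable_fun setT (fun x => cdist N A x `^ r).
Proof.
move=> A0; apply: (@measurableT_comp _ _ _ _ _ _ (fun x : R => x `^ r)).
  exact: measurable_powR.
by apply: continuous_measurable_rV; exact: cdist_continuous.
Qed.

Lemma measurable_dist_powR a : measurable_fun setT (fun x : 'rV[R]_d => N (x - a) `^ r).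
Proof.
apply: (@measurableT_comp _ _ _ _ _ _ (fun x : R => x `^ r)).
  exact: measurable_powR.
by apply: continuous_measurable_rV; exact: dist_norm_continuous.
Qed.

Lemma distortionE A : A != fset0 ->
  distortion N P r A = (\int[P]_x (cdist N A x `^ r)%:E)%E.
Proof.
by move=> A0; apply: eq_integral => x _; rewrite cdistE// poweR_EFin.
Qed.

Lemma distortion0 : distortion N P r fset0 = +oo%E.
Proof.
rewrite /distortion (_ : (fun x => _) = cst +oo%E).
  by rewrite integral_cst// [X in (_ * X)%E](probability_setT P) mule1.
apply/funext => x; rewrite /dist_to (_ : [set` fset0] = set0).
  by rewrite image_set0 ereal_inf0 poweRyr// gt_eqF.
by rewrite -subset0 => z.
Qed.

Lemma quantization_error_pow_le n A : A != fset0 -> (#|` A| <= n)%N ->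
  (quantization_error_pow N P r n <= distortion N P r A)%E.
Proof.
by move=> A0 An; apply: ereal_inf_lbound; exists A => //=; rewrite cardfs_gt0 A0.
Qed.

End quantization_error.

(** From here on, the facts used about [P], besides that its support has full
    mass, are that this support is contained in a ball of radius [L] ([K_sub]),
    that every ball of radius [s] has mass at most [M s ^ d] ([P_ball_le]), and
    that it has mass at least [c s ^ d] if moreover its center is in the support
    and [s < s0] ([P_ball_ge]). Connectedness of the support is added further
    below. *)
Section optimal_codebooks.
Context {R : realType} {d : nat} (d_gt0 : (0 < d)%N).
Context (N : 'rV[R]_d -> R) (N_norm : is_norm N).
Context (r : R) (r_gt0 : 0 < r) (P : probability 'rV[R]_d R).
Local Notation K := (msupport P).
Local Notation h := (@scale R d).
Context (k0 : 'rV[R]_d).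
Context (L : R) (L_gt0 : 0 < L) (K_sub : forall x, K x -> N (x - k0) <= L).
Context (M : R) (M_gt0 : 0 < M) (P_ball_le : forall a s, 0 <= s ->
  (P (norm_ball N a s) <= (M * s ^+ d)%:E)%E).
Context (c s0 : R) (c_gt0 : 0 < c) (s0_gt0 : 0 < s0)
  (P_ball_ge : forall x s, K x -> 0 < s < s0 ->
    ((c * s ^+ d)%:E <= P (norm_ball N x s))%E).
Context (alpha : nat -> {fset 'rV[R]_d})
  (alpha_opt : forall n, (1 <= n)%N -> optimal_codebook N P r n (alpha n)).
Local Notation D n x := (cdist N (alpha n) x).
Local Notation "\D[ A ]" := (\int[P]_x (cdist N A x `^ r)%:E)%E (at level 0).

(** The [r]-th power of the quantization error as a real number; it is finite
    for [n >= 1] by [errE]. *)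
Definition err n : R := fine (quantization_error_pow N P r n).

Let r_ge0 : 0 <= r. Proof. exact: ltW. Qed.

Lemma ae_msupport : \forall x \ae P, K x.
Proof.
exists (~` K); split => //; last exact: msupport_full.
by apply: measurableC; rewrite -[K]setCK; apply: measurableC;
  apply: open_measurable_rV; apply/closed_openC/msupport_closed.
Qed.

Lemma dist_msupport x y : K x -> K y -> N (x - y) <= L *+ 2.
Proof.
move=> Kx Ky; rewrite mulr2n (le_trans (is_norm_distD N_norm k0 _ _))//.
by rewrite lerD// ?K_sub// (is_norm_distC N_norm) K_sub.
Qed.

Lemma error_pow_lty n : (1 <= n)%N ->
  (quantization_error_pow N P r n <= (L `^ r)%:E)%E.
Proof.
move=> n1; have k0A : [fset k0]%fset != fset0 by apply/fset0Pn; exists k0; rewrite inE.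
rewrite (le_trans (quantization_error_pow_le N r P k0A (n := n) _))//.
  by rewrite cardfs1.
rewrite distortionE//.
have := @ge0_integral_set_le _ _ _ P K ae_msupport
  (fun x => cdist N [fset k0]%fset x `^ r) (L `^ r) setT.
rewrite probability_setT mule1; apply => //.
- exact: measurable_cdist_powR.
- by move=> x; exact: powR_ge0.
- exact: powR_ge0.
- move=> x Kx _; apply: ler_powR_base => //; first exact: cdist_ge0.
  by rewrite (le_trans _ (K_sub Kx))//; apply: cdist_le; rewrite inE.
Qed.

Lemma errE n : (1 <= n)%N -> quantization_error_pow N P r n = (err n)%:E.
Proof.
move=> n1; rewrite /err fineK// ge0_fin_numE.
  by rewrite (le_lt_trans (error_pow_lty n1))// ltry.
have [_ <-] := alpha_opt n1; apply: integral_ge0 => x _; exact: poweR_ge0.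
Qed.

Lemma alpha_neq0 n : (1 <= n)%N -> alpha n != fset0.
Proof.
move=> n1; apply/eqP => A0; have [_] := alpha_opt n1.
by rewrite A0 distortion0// errE.
Qed.

Lemma card_alpha n : (1 <= n)%N -> (#|` alpha n| <= n)%N.
Proof. by move=> /alpha_opt[]. Qed.

Lemma err_alpha n : (1 <= n)%N -> \D[alpha n] = (err n)%:E.
Proof.
by move=> n1; rewrite -errE// -distortionE ?alpha_neq0//; have [] := alpha_opt n1.
Qed.

Lemma err_le n A : (1 <= n)%N -> A != fset0 -> (#|` A| <= n)%N ->
  ((err n)%:E <= \D[A])%E.
Proof.
by move=> n1 A0 An; rewrite -errE// -distortionE// quantization_error_pow_le.
Qed.

(** Every point of the support is served at a bounded distance: otherwise a
    single point of the support would be a better codebook. *)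
Lemma cdist_alpha_bounded n x : (1 <= n)%N -> K x -> D n x <= L *+ 4.
Proof.
move=> n1 Kx; have A0 := alpha_neq0 n1.
have [y [Ky yL]] : exists y, K y /\ D n y <= L *+ 2.
  apply: contrapT => /forallNP H.
  have : (((L *+ 2) `^ r)%:E <= (err n)%:E)%E.
    rewrite -err_alpha//.
    have := @ge0_integral_set_ge _ _ _ P K ae_msupport
      (fun x => D n x `^ r) ((L *+ 2) `^ r) setT setT.
    rewrite probability_setT mule1; apply => //.
    - exact: measurable_cdist_powR.
    - by move=> z; exact: powR_ge0.
    - exact: powR_ge0.
    - move=> z Kz _; apply: ler_powR_base => //; first by rewrite mulrn_wge0// ltW.
      by rewrite leNgt; apply/negP => /ltW zL; apply: (H z).
  apply/negP; rewrite -ltNge -errE//; apply: le_lt_trans (error_pow_lty n1) _.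
  rewrite lte_fin; apply: ltr_powR_base => //; first exact: ltW.
  by rewrite mulr2n ltrDl.
rewrite (le_trans (cdist_lipschitz_le N_norm _ y A0))//.
have -> : L *+ 4 = L *+ 2 + L *+ 2 by rewrite -mulrnDr.
by rewrite lerD// dist_msupport.
Qed.

Lemma err_nincr n : (1 <= n)%N -> err n.+1 <= err n.
Proof.
move=> n1; rewrite -lee_fin -[leRHS]err_alpha//; apply: err_le => //.
  exact: alpha_neq0.
by rewrite (leq_trans (card_alpha n1)).
Qed.

(** Micro-macro inequality: adding a point [x] of the support to an optimal
    codebook improves it on a small ball around [x], whose mass is bounded below
    by peaklessness. *)
Lemma err_drop_ge : exists2 kappa : R, 0 < kappa & forall n x, (1 <= n)%N ->
  K x -> err n.+1 + kappa * (D n x `^ r * D n x ^+ d) <= err n.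
Proof.
(* The ball has radius [b * D n x]; the second bound makes it smaller than [s0],
   as [D n x <= 4 L], and [b <= 1 / 4] makes [x] a better server inside it. *)
pose b := Num.min (4^-1) (s0 / (L *+ 8)).
have b0 : 0 < b by rewrite lt_min invr_gt0 ltr0n/= divr_gt0// pmulrn_lgt0.
have b4 : b <= 4^-1 by rewrite ge_min lexx.
have bL : b * (L *+ 4) < s0.
  apply: (@le_lt_trans _ _ (s0 / 2)); last by rewrite ltr_pdivrMr// ltr_pMr// ltr1n.
  apply: (@le_trans _ _ (s0 / (L *+ 8) * (L *+ 4))).
    by rewrite ler_wpM2r ?mulrn_wge0 ?(ltW L_gt0)// ge_min lexx orbT.
  rewrite le_eqVlt; apply/orP; left; apply/eqP.
  by rewrite -!(mulr_natr L); field; rewrite gt_eqF.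
have b1 : b < 1 - b by lra.
pose g := (1 - b) `^ r - b `^ r.
have g0 : 0 < g by rewrite subr_gt0; apply: ltr_powR_base => //; exact: ltW.
exists (g * (c * b ^+ d)); first by rewrite !mulr_gt0// exprn_gt0.
move=> n x n1 Kx; have A0 := alpha_neq0 n1.
set del := D n x.
have [del0|] := eqVneq del 0.
  by rewrite del0 expr0n gtn_eqF// !mulr0 addr0 err_nincr.
have del_ge0 : 0 <= del := cdist_ge0 N_norm _ _.
rewrite neq_lt ltNge del_ge0/= => del_gt0.
have bs : 0 < b * del < s0.
  rewrite mulr_gt0//= (le_lt_trans _ bL)// ler_wpM2l ?(ltW b0)//.
  exact: cdist_alpha_bounded.
have := P_ball_ge Kx bs; set U := norm_ball _ _ _ => PU.
pose A := (x |` alpha n)%fset.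
have AA : A != fset0 by apply/fset0Pn; exists x; rewrite !inE eqxx.
have := @ge0_integral_add_le _ _ _ P K ae_msupport
  (fun y => cdist N A y `^ r) (fun y => D n y `^ r) (g * del `^ r) U.
rewrite err_alpha// => le1.
have {le1} : (\D[A] + (g * del `^ r)%:E * P U <= (err n)%:E)%E.
  apply: le1.
  - exact: measurable_cdist_powR.
  - exact: measurable_cdist_powR.
  - by move=> y; exact: powR_ge0.
  - by move=> y; exact: powR_ge0.
  - by rewrite mulr_ge0 ?powR_ge0// ltW.
  - exact: measurable_norm_ball.
  - move=> y _ Uy.
    have y1 : cdist N A y <= b * del.
      rewrite (le_trans (cdist_le _ _ (a := x) _)) ?inE ?eqxx//.
      exact: ltW.
    have y2 : (1 - b) * del <= D n y.
      rewrite mulrBl mul1r lerBlDr (le_trans (cdist_lipschitz_le N_norm x y A0))//.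
      by rewrite addrC lerD2l (is_norm_distC N_norm) ltW.
    have : cdist N A y `^ r <= (b * del) `^ r.
      by apply: ler_powR_base => //; exact: cdist_ge0.
    have : ((1 - b) * del) `^ r <= D n y `^ r.
      by apply: ler_powR_base => //; rewrite mulr_ge0//; lra.
    rewrite !powRM//; [|exact: ltW|lra].
    rewrite /g mulrBl => hi lo.
    by rewrite addrCA (le_trans _ hi)// gerDl subr_le0.
  - move=> y _ _; apply: ler_powR_base => //; first exact: cdist_ge0.
    by apply: cdist_antimono => //; exact: fsubsetUr.
move=> le2; rewrite -lee_fin (le_trans _ le2)// EFinD; apply: leeD.
  by apply: err_le => //; rewrite cardfsU1 -(add1n n) leq_add ?leq_b1 ?card_alpha.
have -> : g * (c * b ^+ d) * (del `^ r * del ^+ d) =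
  g * del `^ r * (c * (b * del) ^+ d) by rewrite exprMn; ring.
by rewrite EFinM lee_wpmul2l// lee_fin mulr_ge0 ?powR_ge0// ltW.
Qed.

Lemma probability_fset_bigcup (A : {fset 'rV[R]_d}) (s : R) : 0 <= s ->
  (P (\big[setU/set0]_(a <- A) norm_ball N a s) <= (#|` A|%:R * (M * s ^+ d))%:E)%E.
Proof.
move=> s_ge0; have -> : (#|` A|%:R * (M * s ^+ d))%:E =
    (\sum_(a <- A) (M * s ^+ d)%:E)%E.
  by rewrite sumEFin big_const_seq count_predT iter_addr addr0 mulr_natl.
elim: (enum_fset A) => [|a A' IH]; first by rewrite !big_nil measure0.
rewrite !big_cons (le_trans (measureU2 _ _ _))//.
- exact: measurable_norm_ball.
- by apply: bigsetU_measurable => *; exact: measurable_norm_ball.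
- by rewrite leeD// P_ball_le.
Qed.

(** Small balls around [n] points cannot cover half of the mass. *)
Lemma far_from_alpha : exists2 t : R, 0 < t & forall n, (1 <= n)%N ->
  exists2 B : set 'rV[R]_d, measurable B &
    ((2^-1)%:E <= P B)%E /\ forall x, B x -> t * h n <= D n x.
Proof.
(* The balls have total mass at most [n * M * (t * h n) ^ d = M * t ^ d]. *)
pose t := Num.min 1 (M *+ 2)^-1.
have t0 : 0 < t by rewrite lt_min ltr01/= invr_gt0 pmulrn_lgt0.
exists t => // n n1; have hn : 0 < h n := @scale_gt0 R d n n1.
have th : 0 <= t * h n := mulr_ge0 (ltW t0) (ltW hn).
pose U := \big[setU/set0]_(a <- alpha n) norm_ball N a (t * h n).
have mU : measurable U.
  by apply: bigsetU_measurable => *; exact: measurable_norm_ball.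
exists (~` U); first exact: measurableC.
have PU : (P U <= (2^-1)%:E)%E.
  rewrite (le_trans (probability_fset_bigcup _ th))// lee_fin.
  rewrite (@le_trans _ _ (n%:R * (M * (t * h n) ^+ d)))//.
    rewrite ler_wpM2r ?ler_nat ?card_alpha// mulr_ge0 ?(ltW M_gt0)//.
    by rewrite exprn_ge0.
  rewrite exprMn scaleX//.
  have -> : n%:R * (M * (t ^+ d * n%:R^-1)) = M * t ^+ d.
    by field; rewrite pnatr_eq0 -lt0n.
  rewrite (@le_trans _ _ (M * t))//.
    rewrite ler_wpM2l ?(ltW M_gt0)//.
    case: d d_gt0 => // k _; rewrite exprS ler_piMr ?(ltW t0)//.
    by rewrite exprn_ile1// ?(ltW t0)// ge_min lexx.
  by rewrite mulrC -ler_pdivlMr// -invfM mulr_natl ge_min lexx orbT.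
split.
  rewrite probability_setC// -[P U]fineK ?fin_num_measure// -EFinB lee_fin.
  rewrite -[P U]fineK ?fin_num_measure// lee_fin in PU; lra.
move=> x xU; have [a aA ->] := cdist_nearest N (alpha_neq0 n1) x.
rewrite leNgt; apply/negP => lt; apply: xU; rewrite /U big_seq.
by rewrite (big_rem a)/= ?aA; [left|].
Qed.

Lemma err_ge : exists2 c2 : R, 0 < c2 & forall n, (1 <= n)%N ->
  c2 * h n `^ r <= err n.
Proof.
have [t t0 far] := far_from_alpha.
exists (t `^ r / 2); first by rewrite divr_gt0// powR_gt0.
move=> n n1; have [B mB [PB Bfar]] := far n n1.
have hn : 0 < h n := @scale_gt0 R d n n1.
rewrite -lee_fin -err_alpha//.
have le1 := @ge0_integral_set_ge _ _ _ P K ae_msupport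
  (fun x => D n x `^ r) ((t * h n) `^ r) B setT.
apply: le_trans (le1 _ _ _ _ _ _ _) => //.
- have -> : t `^ r / 2 * h n `^ r = (t * h n) `^ r * 2^-1.
    by rewrite powRM ?(ltW t0) ?(ltW hn)//; ring.
  by rewrite EFinM lee_wpmul2l// lee_fin powR_ge0.
- by apply: measurable_cdist_powR => //; exact: alpha_neq0.
- by move=> x; exact: powR_ge0.
- exact: powR_ge0.
- move=> x _ Bx; apply: ler_powR_base => //; last exact: Bfar.
  exact: mulr_ge0 (ltW t0) (ltW hn).
Qed.

(** The drop of the error from [n - 1] to [n] is at least of the order
    [h n ^ r / n]: apply the micro-macro inequality at a point of the support
    that is far from the codebook. *)
Lemma err_drop_scale_ge : exists2 c6 : R, 0 < c6 & forall n, (2 <= n)%N ->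
  err n + c6 * (h n `^ r / n%:R) <= err n.-1.
Proof.
have [t t0 far] := far_from_alpha; have [kappa kappa0 drop] := err_drop_ge.
exists (kappa * (t `^ r * t ^+ d)).
  by rewrite !mulr_gt0// ?powR_gt0// exprn_gt0.
case=> // n; rewrite ltnS => n1; have [B mB [PB Bfar]] := far n n1.
have [x [Kx Bx]] : exists x, K x /\ B x.
  apply: contrapT => /forallNP H; move: PB; apply/negP; rewrite -ltNge.
  apply: (@le_lt_trans _ _ (P set0)); last by rewrite measure0 lte_fin invr_gt0.
  apply: (probability_le_ae mB measurable0 ae_msupport) => y Ky By.
  exact: (H y).
have hn : 0 < h n.+1 := @scale_gt0 R d n.+1 isT.
apply: le_trans (drop n x n1 Kx); rewrite lerD2l -mulrA ler_wpM2l ?(ltW kappa0)//.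
rewrite -(@scaleX R d d_gt0) mulrACA.
have th : t * h n.+1 <= D n x.
  by rewrite (le_trans _ (Bfar x Bx))// ler_wpM2l ?(ltW t0)// le_scale.
have th0 : 0 <= t * h n.+1 := mulr_ge0 (ltW t0) (ltW hn).
rewrite -powRM ?(ltW t0) ?(ltW hn)// -exprMn.
by rewrite ler_pM ?powR_ge0 ?exprn_ge0// ?ler_powR_base// lerXn2r// nnegrE cdist_ge0.
Qed.


(** * Order of the error and of its drop *)

Lemma card_ffun_ord q : #|{ffun 'I_d -> 'I_q}| = (q ^ d)%N.
Proof. by rewrite card_ffun !card_ord. Qed.

(** Upper bound of the error: one representative in every cell of a grid that
    meets the support. *)
Lemma err_le_scale : exists2 C1 : R, 0 < C1 & forall n, (1 <= n)%N ->
  err n <= C1 * h n `^ r.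
Proof.
have [Cg Cg0 grid] := norm_ball_grid N_norm k0 L_gt0.
exists (L `^ r + (Cg * 4) `^ r); first by rewrite addr_gt0// powR_gt0// mulr_gt0.
move=> n n1; have hn : 0 < h n := @scale_gt0 R d n n1.
have [n2|] := leqP 2 n; last first.
  rewrite ltnS => n1'; have -> : n = 1%N by apply/eqP; rewrite eqn_leq n1 n1'.
  rewrite /= scale1 powR1 mulr1 -lee_fin -errE// (le_trans (error_pow_lty _))//.
  by rewrite lee_fin lerDl powR_ge0.
have [q [q0 qn qh]] := @grid_size R d d_gt0 n n2; have [cell cellP] := grid q q0.
pose rep u := xget k0 [set x | K x /\ cell x = u].
pose A := [fset x in map rep (enum {ffun 'I_d -> 'I_q})]%fset.
have repA u : rep u \in A by rewrite inE map_f// mem_enum.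
have An : (#|` A| <= n)%N.
  rewrite card_fseq (leq_trans (size_undup _))// size_map -cardE card_ffun_ord.
  by rewrite (leq_trans _ qn)// leq_pmull.
have A0 : A != fset0 by apply/fset0Pn; exists (rep (cell k0)).
rewrite -lee_fin (le_trans (err_le n1 A0 An))//.
have le1 := @ge0_integral_set_le _ _ _ P K ae_msupport
  (fun x => cdist N A x `^ r) ((Cg * 4 * h n) `^ r) setT.
rewrite probability_setT mule1 in le1.
apply: le_trans (le1 _ _ _ _ _) _ => //.
- exact: measurable_cdist_powR.
- by move=> x; exact: powR_ge0.
- exact: powR_ge0.
- move=> x Kx _; apply: ler_powR_base => //; first exact: cdist_ge0.
  have [Krep crep] : K (rep (cell x)) /\ cell (rep (cell x)) = cell x.
    by apply: (xgetI k0 (P := [set y | K y /\ cell y = cell x]) (x := x)).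
  rewrite (le_trans (cdist_le _ _ (repA (cell x))))//.
  rewrite (le_trans (cellP _ _ (K_sub Kx) (K_sub Krep) (esym crep)))//.
  by rewrite -mulrA ler_wpM2l// ltW.
- rewrite lee_fin powRM ?(ltW hn)//; last by rewrite mulr_ge0// ltW.
  by rewrite ler_wpM2r ?powR_ge0// lerDr powR_ge0.
Qed.

Lemma open_voronoi_measurable A a : measurable (open_voronoi N A a).
Proof. by apply: open_measurable_rV; exact: open_voronoi_open. Qed.

Lemma voronoi_measurable A a : a \in A -> measurable (voronoi N A a).
Proof.
move=> aA; rewrite -[X in measurable X]setCK; apply: measurableC.
by apply: open_measurable_rV; apply/closed_openC; exact: voronoi_closed.
Qed.

(** Removing a point [a] from an optimal codebook is paid for on the open
    Voronoi cell of [a] only. *)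
Lemma err_remove n a (G : 'rV[R]_d -> R) : (2 <= n)%N -> a \in alpha n ->
  (alpha n `\ a)%fset != fset0 ->
  measurable_fun setT G -> (forall x, 0 <= G x) ->
  (forall x, K x -> open_voronoi N (alpha n) a x ->
    cdist N (alpha n `\ a)%fset x `^ r <= D n x `^ r + G x) ->
  ((err n.-1)%:E <=
     (err n)%:E + \int[P]_(x in open_voronoi N (alpha n) a) (G x)%:E)%E.
Proof.
move=> n2 aA B0 mG G0 HG; have n1 : (1 <= n)%N := ltnW n2.
have A0 := alpha_neq0 n1.
rewrite -(err_alpha n1).
have le1 := @ge0_integral_le_addset _ _ _ P K ae_msupport
  (fun x => cdist N (alpha n `\ a)%fset x `^ r) (fun x => D n x `^ r) G
  (open_voronoi N (alpha n) a).
apply: (le_trans _ (le1 _ _ _ _ _ _ _ _ _)) => //.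
- apply: err_le => //; first by rewrite -ltnS prednK.
  by rewrite -ltnS prednK// (leq_trans _ (card_alpha n1))// [leqRHS](cardfsD1 a) aA.
- exact: measurable_cdist_powR.
- exact: measurable_cdist_powR.
- by move=> x; exact: powR_ge0.
- by move=> x; exact: powR_ge0.
- exact: open_voronoi_measurable.
- move=> x _ nV; apply: ler_powR_base => //; first exact: cdist_ge0.
  exact: cdist_remove_out.
Qed.

(** The drop of the error from [n - 1] to [n] is at most of the order
    [h n ^ r / n]. If the codebook has fewer than [n] points, or a point whose
    open cell misses the support, there is no drop at all. Otherwise all its
    points lie in a fixed ball, so by pigeonhole half of them have a close
    neighbour, and removing the least useful one of these is cheap. *)
Lemma err_drop_scale_le : exists2 C3 : R, 0 < C3 & forall n, (2 <= n)%N ->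
  err n.-1 <= err n + C3 * (h n `^ r / n%:R).
Proof.
have [C1 C10 err1] := err_le_scale.
have L5 : 0 < L *+ 5 by rewrite pmulrn_lgt0.
have [Cg Cg0 grid] := norm_ball_grid N_norm k0 L5.
pose C' := 2 `^ r * (C1 + (Cg * 4) `^ r).
have C'0 : 0 < C' by rewrite mulr_gt0 ?addr_gt0 ?powR_gt0// mulr_gt0.
exists (C' *+ 2); first by rewrite pmulrn_lgt0.
move=> n n2; have n1 : (1 <= n)%N := ltnW n2.
have n0R : 0 < n%:R :> R by rewrite ltr0n.
have hn : 0 < h n := @scale_gt0 R d n n1; have A0 := alpha_neq0 n1.
have pos : 0 <= C' *+ 2 * (h n `^ r / n%:R).
  by rewrite mulr_ge0 ?mulrn_wge0 ?(ltW C'0)// divr_ge0// powR_ge0.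
have [cA|cA] := leqP #|` alpha n| n.-1.
  apply: (@le_trans _ _ (err n)); last by rewrite lerDl.
  rewrite -lee_fin -[leRHS](err_alpha n1); apply: err_le => //.
  by rewrite -ltnS prednK.
have {}cA : #|` alpha n| = n.
  by apply/eqP; rewrite eqn_leq card_alpha// -{1}(prednK n1).
have B0 a : a \in alpha n -> (alpha n `\ a)%fset != fset0.
  move=> aA; have := cardfsD1 a (alpha n); rewrite aA cA add1n => E.
  by rewrite -cardfs_gt0 -ltnS -E.
have [[a [aA Ka]]|Hn] := pselect (exists a, a \in alpha n /\
    forall x, K x -> ~ open_voronoi N (alpha n) a x).
  have := @err_remove n a (cst 0) n2 aA (B0 a aA).
  rewrite [X in (_ + X)%E]integral0_eq// adde0 lee_fin => le1.
  apply: le_trans (le1 _ _ _) _ => //; last by rewrite lerDl.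
  by move=> x Kx /(Ka x Kx).
have far a : a \in alpha n -> N (a - k0) <= L *+ 5.
  move=> aA; have [x [Kx Vx]] : exists x, K x /\ open_voronoi N (alpha n) a x.
    apply: contrapT => /forallNP H; apply: Hn; exists a; split=> // x Kx Vx.
    by apply: (H x).
  rewrite (le_trans (is_norm_distD N_norm x _ _))// mulrSr lerD// ?K_sub//.
  rewrite (is_norm_distC N_norm).
  move/(open_voronoi_sub aA)/(voronoiP N x aA) : Vx => <-.
  exact: cdist_alpha_bounded.
have [q [q0 qn qh]] := @grid_size R d d_gt0 n n2; have [cell cellP] := grid q q0.
have [|S [SA nS SP]] := @pigeonhole_half _ _ cell (alpha n).
  by rewrite card_ffun_ord cA.
pose rho := Cg * 4 * h n.
have rho0 : 0 < rho by rewrite !mulr_gt0.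
(* A bound on the loss at [x] when its nearest point is replaced by a neighbour of it. *)
pose G x := (D n x + rho) `^ r.
have mG : measurable_fun setT G.
  apply: (@measurableT_comp _ _ _ _ _ _ (fun x : R => x `^ r)).
    exact: measurable_powR.
  apply: measurable_funD => //.
  by apply: continuous_measurable_rV; exact: cdist_continuous.
have G0 x : 0 <= G x := powR_ge0 _ _.
have intG : (\int[P]_x (G x)%:E <= (C' * h n `^ r)%:E)%E.
  have le1 := @ge0_integral_le_add _ _ _ P K ae_msupport G
    (fun x => 2 `^ r * D n x `^ r) (2 `^ r * rho `^ r) setT.
  rewrite probability_setT mule1 in le1.
  apply: le_trans (le1 _ _ _ _ _ _ _ _) _ => //.
  - by apply: measurable_funM => //; exact: measurable_cdist_powR.
  - by move=> x; rewrite mulr_ge0 ?powR_ge0.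
  - by rewrite mulr_ge0 ?powR_ge0.
  - move=> x _ _; rewrite -!powRM ?cdist_ge0 ?(ltW rho0)//.
    have D0 := cdist_ge0 N_norm (alpha n) x.
    have [Dr|rD] := leP (D n x) rho.
      apply: (@le_trans _ _ ((2 * rho) `^ r)); last by rewrite lerDr powR_ge0.
      apply: ler_powR_base => //; first by rewrite addr_ge0// ltW.
      by rewrite mulr_natl mulr2n lerD2r.
    apply: (@le_trans _ _ ((2 * D n x) `^ r)); last by rewrite lerDl powR_ge0.
    apply: ler_powR_base => //; first by rewrite addr_ge0// ltW.
    by rewrite mulr_natl mulr2n lerD2l ltW.
  - by move=> x _ /(_ I).
  - under eq_integral do rewrite EFinM.
    rewrite ge0_integralZl//; last 2 first.
    + by apply/measurable_EFinP; exact: measurable_cdist_powR.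
    + by move=> x _; rewrite lee_fin powR_ge0.
    rewrite err_alpha// -EFinM -EFinD lee_fin /rho powRM ?(ltW hn)//; last first.
      by rewrite mulr_ge0// ltW.
    rewrite -mulrDr /C' -mulrA ler_wpM2l ?powR_ge0// mulrDl lerD2r.
    exact: err1.
have [t0|t0] := leP (err n.-1) (err n).
  by rewrite (le_trans t0)// lerDl.
have := @ge0_integral_disjoint_ge _ _ _ P _ S (open_voronoi N (alpha n)) G
  (err n.-1 - err n) mG G0 (open_voronoi_measurable _).
have tS : trivIset [set` S] (open_voronoi N (alpha n)).
  apply: sub_trivIset (@open_voronoi_trivIset _ _ N (alpha n)) => a /= aS.
  exact: (fsubsetP SA).
move=> /(_ tS) le2.
have {le2} : ((#|` S|%:R * (err n.-1 - err n))%:E <= \int[P]_x (G x)%:E)%E.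
  apply: le2 => a aS; have aA := fsubsetP SA a aS.
  have [b bA [ba cba]] := SP a aS.
  have ab : N (a - b) <= rho.
    rewrite (le_trans (cellP _ _ (far a aA) (far b bA) (esym cba)))//.
    by rewrite /rho -mulrA ler_wpM2l// ltW.
  rewrite EFinB leeBlDl//; apply: err_remove => //; first exact: B0.
  move=> x Kx Vx; apply: (@le_trans _ _ (G x)); last by rewrite lerDr powR_ge0.
  apply: ler_powR_base => //; first exact: cdist_ge0.
  by rewrite (le_trans (cdist_remove_in N_norm aA Vx bA ba))// lerD2l.
move=> /le_trans/(_ intG); rewrite lee_fin => le3.
rewrite -lerBlDl mulrA ler_pdivlMr//.
rewrite (@le_trans _ _ (2 * (#|` S|%:R * (err n.-1 - err n))))//.
  rewrite mulrA mulrC ler_wpM2r ?subr_ge0 ?(ltW t0)//.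
  by rewrite -natrM ler_nat -{1}cA.
have -> : C' *+ 2 * h n `^ r = 2 * (C' * h n `^ r).
  by rewrite mulrnAl -mulr_natl.
by rewrite ler_wpM2l.
Qed.

(** Consequently every point of the support lies within the order of [scale n]
    of an optimal codebook. *)
Lemma cdist_alpha_le : exists2 C5 : R, 0 < C5 & forall n x, (1 <= n)%N ->
  K x -> D n x <= C5 * h n.
Proof.
have [kappa kappa0 drop] := err_drop_ge.
have [C3 C30 drop_le] := err_drop_scale_le.
(* As [C5 >= 1], [C5 ^ r * C5 ^ d >= C5 > C3 / kappa], which contradicts the
   two bounds on the drop. *)
pose C5 := 1 + C3 / kappa; have C51 : 1 <= C5 by rewrite lerDl divr_ge0 ?ltW.
have C50 : 0 < C5 by apply: lt_le_trans C51.
exists C5 => // n x n1 Kx; rewrite leNgt; apply/negP => Dgt.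
have hn : 0 < h n.+1 := @scale_gt0 R d n.+1 isT.
have Dh : C5 * h n.+1 <= D n x.
  by rewrite (le_trans _ (ltW Dgt))// ler_wpM2l ?(ltW C50)// le_scale.
have Ch0 : 0 <= C5 * h n.+1 := mulr_ge0 (ltW C50) (ltW hn).
have := le_trans (drop n x n1 Kx) (drop_le n.+1 n1).
rewrite lerD2l -(@scaleX R d d_gt0) => le1.
set u := h n.+1 `^ r * h n.+1 ^+ d in le1.
have u0 : 0 < u by rewrite mulr_gt0 ?powR_gt0 ?exprn_gt0.
have : C5 * u <= D n x `^ r * D n x ^+ d.
  apply: (@le_trans _ _ ((C5 * h n.+1) `^ r * (C5 * h n.+1) ^+ d)); last first.
    by apply: ler_pM; rewrite ?powR_ge0 ?exprn_ge0 ?ler_powR_base// lerXn2r ?nnegrE// cdist_ge0.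
  rewrite powRM ?(ltW C50) ?(ltW hn)// exprMn mulrACA -/u ler_wpM2r ?(ltW u0)//.
  rewrite -[leLHS]mul1r ler_pM ?(ltW C50)//.
    by have := ler_powR_base r_ge0 (@ler01 R) C51; rewrite powR1.
  by case: d d_gt0 => // k _; rewrite exprS ler_peMr ?(ltW C50)// exprn_ege1.
move=> /(ler_wpM2l (ltW kappa0))/le_trans/(_ le1).
rewrite mulrA ler_pM2r// /C5 mulrDr mulr1 mulrCA mulfV ?gt_eqF// mulr1.
by apply/negP; rewrite -ltNge ltrDr.
Qed.

(** * Mass, loss and radii of the cells *)

Lemma err_lt n : (2 <= n)%N -> err n < err n.-1.
Proof.
have [c6 c60 drop] := err_drop_scale_ge => n2.
have n1 : (1 <= n)%N := ltnW n2.
apply: lt_le_trans (drop n n2); rewrite ltrDl mulr_gt0// divr_gt0 ?ltr0n//.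
by rewrite powR_gt0// scale_gt0.
Qed.

Lemma remove_alpha_neq0 n a : (2 <= n)%N -> a \in alpha n ->
  (alpha n `\ a)%fset != fset0.
Proof.
move=> n2 aA; have n1 : (1 <= n)%N := ltnW n2.
apply/eqP => E; have := err_lt n2; apply/negP; rewrite -leNgt.
rewrite -lee_fin -[leRHS](err_alpha n1); apply: err_le.
- by rewrite -ltnS prednK.
- exact: alpha_neq0.
- by rewrite (cardfsD1 a) aA E cardfs0 -ltnS prednK.
Qed.

Lemma open_voronoi_meets_support n a : (2 <= n)%N -> a \in alpha n ->
  exists x, K x /\ open_voronoi N (alpha n) a x.
Proof.
move=> n2 aA; apply: contrapT => /forallNP H.
have := @err_remove n a (cst 0) n2 aA (remove_alpha_neq0 n2 aA).
rewrite [X in (_ + X)%E]integral0_eq// adde0 lee_fin => le1.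
have := err_lt n2; apply/negP; rewrite -leNgt; apply: le1 => // x Kx Vx.
by case: (H x).
Qed.

Lemma voronoi_dist n a x : (1 <= n)%N -> a \in alpha n ->
  voronoi N (alpha n) a x -> N (x - a) = D n x.
Proof. by move=> n1 aA /(voronoiP N x aA). Qed.

Lemma mass_voronoi_le : exists2 C : R, 0 < C & forall n a, (1 <= n)%N ->
  a \in alpha n -> (P (voronoi N (alpha n) a) <= (C / n%:R)%:E)%E.
Proof.
have [C5 C50 DC5] := cdist_alpha_le.
exists (M * (C5 *+ 2) ^+ d).
  by rewrite mulr_gt0// exprn_gt0// pmulrn_lgt0.
move=> n a n1 aA; have hn : 0 < h n := @scale_gt0 R d n n1.
have s_gt0 : 0 < C5 *+ 2 * h n by rewrite mulr_gt0// pmulrn_lgt0.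
have := P_ball_le a (ltW s_gt0); rewrite exprMn scaleX// mulrA.
apply: le_trans.
apply: (probability_le_ae _ _ ae_msupport).
- exact: voronoi_measurable.
- exact: measurable_norm_ball.
- move=> x Kx /(voronoi_dist n1 aA) E; rewrite /norm_ball/= E.
  by rewrite (le_lt_trans (DC5 n x n1 Kx))// ltr_pM2r// mulr2n ltrDl.
Qed.

Lemma loss_voronoi_le : exists2 C : R, 0 < C & forall n a, (1 <= n)%N ->
  a \in alpha n ->
  (\int[P]_(x in voronoi N (alpha n) a) (N (x - a) `^ r)%:E <=
    (C * (h n `^ r / n%:R))%:E)%E.
Proof.
have [C5 C50 DC5] := cdist_alpha_le; have [C C0 PC] := mass_voronoi_le.
exists (C5 `^ r * C); first by rewrite mulr_gt0// powR_gt0.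
move=> n a n1 aA; have hn : 0 < h n := @scale_gt0 R d n n1.
have le1 := @ge0_integral_set_le _ _ _ P K ae_msupport
  (fun x => N (x - a) `^ r) ((C5 * h n) `^ r) (voronoi N (alpha n) a).
apply: le_trans (le1 _ _ _ _ _) _.
- exact: measurable_dist_powR.
- by move=> x; exact: powR_ge0.
- exact: powR_ge0.
- exact: voronoi_measurable.
- move=> x Kx /(voronoi_dist n1 aA) ->; apply: ler_powR_base => //.
    exact: cdist_ge0.
  exact: DC5.
have -> : C5 `^ r * C * (h n `^ r / n%:R) = (C5 * h n) `^ r * (C / n%:R).
  by rewrite powRM ?(ltW C50) ?(ltW hn)//; ring.
rewrite EFinM.
by rewrite lee_wpmul2l ?lee_fin ?powR_ge0//; exact: PC.
Qed.

Lemma circumradius_le : exists2 C : R, 0 < C & forall n a, (1 <= n)%N ->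
  a \in alpha n -> (circumradius N P (alpha n) a <= (C * h n)%:E)%E.
Proof.
have [C5 C50 DC5] := cdist_alpha_le.
exists (C5 *+ 2); first by rewrite pmulrn_lgt0.
move=> n a n1 aA; have hn : 0 < h n := @scale_gt0 R d n n1.
apply: ereal_inf_lbound; exists (C5 *+ 2 * h n) => //; split.
  by rewrite mulr_gt0// pmulrn_lgt0.
move=> x [/(voronoi_dist n1 aA) E Kx]; rewrite /norm_ball/= E.
by rewrite (le_lt_trans (DC5 n x n1 Kx))// ltr_pM2r// mulr2n ltrDl.
Qed.

Lemma alpha1_eq a b : a \in alpha 1 -> b \in alpha 1 -> b = a.
Proof.
move=> aA bA; apply/eqP/negPn/negP => ba.
have := card_alpha (n := 1) isT; rewrite (cardfsD1 a) aA (cardfsD1 b).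
by rewrite !inE ba bA.
Qed.

(** If two points were much closer than [scale n], removing one of them would
    cost less than the known drop of the error. *)
Lemma alpha_separated : exists2 c8 : R, 0 < c8 & forall n a b, (1 <= n)%N ->
  a \in alpha n -> b \in alpha n -> b != a -> c8 * h n <= N (a - b).
Proof.
have [C5 C50 DC5] := cdist_alpha_le; have [C C0 PC] := mass_voronoi_le.
have [c6 c60 drop] := err_drop_scale_ge.
have eta0 : 0 < c6 / (C *+ 2) by rewrite divr_gt0// pmulrn_lgt0.
have [eps eps0 unif] := powR_uniform_continuous r_gt0 C50 eta0.
exists eps => // n a b n1 aA bA ba; have hn : 0 < h n := @scale_gt0 R d n n1.
have [n2|] := leqP 2 n; last first.
  rewrite ltnS => n1'; have E : n = 1%N by apply/eqP; rewrite eqn_leq n1 n1'.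
  by move: ba; rewrite E in aA bA; rewrite (alpha1_eq aA bA) eqxx.
rewrite leNgt; apply/negP => lt.
pose w := c6 / (C *+ 2) * h n `^ r.
have w0 : 0 < w by rewrite mulr_gt0// powR_gt0.
have le1 := @err_remove n a (cst w) n2 aA (remove_alpha_neq0 n2 aA).
have {le1} : ((err n.-1)%:E <= (err n)%:E + w%:E * P (open_voronoi N (alpha n) a))%E.
  rewrite -integral_cst; last exact: open_voronoi_measurable.
  apply: le1 => [|x|x Kx Vx]; [exact: measurable_cst|exact: ltW|].
  have D0 := cdist_ge0 N_norm (alpha n) x.
  apply: (@le_trans _ _ ((D n x + N (a - b)) `^ r)).
    apply: ler_powR_base => //; first exact: cdist_ge0.
    exact: cdist_remove_in.
  have -> : D n x + N (a - b) = h n * (D n x / h n + N (a - b) / h n).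
    by field; rewrite gt_eqF.
  have -> : D n x `^ r + cst w x = h n `^ r * ((D n x / h n) `^ r + c6 / (C *+ 2)).
    rewrite mulrDr -powRM ?(ltW hn)//; last by rewrite divr_ge0// ltW.
    by rewrite [h n * _]mulrC divfK ?gt_eqF// [h n `^ r * _]mulrC.
  have hV0 : 0 <= (h n)^-1 by rewrite invr_ge0 ltW.
  rewrite powRM ?(ltW hn)//; last first.
    by rewrite addr_ge0// mulr_ge0// is_norm_ge0.
  rewrite ler_wpM2l ?powR_ge0//; apply: unif; apply/andP; split.
  - exact: mulr_ge0.
  - by rewrite ler_pdivrMr//; exact: DC5.
  - by rewrite mulr_ge0// is_norm_ge0.
  - by rewrite ler_pdivrMr// ltW.
have PV : (P (open_voronoi N (alpha n) a) <= (C / n%:R)%:E)%E.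
  rewrite (le_trans _ (PC n a n1 aA))//; apply: le_measure; rewrite ?inE.
  - exact: open_voronoi_measurable.
  - exact: voronoi_measurable.
  - exact: open_voronoi_sub.
have := lee_wpmul2l (ltW w0 : (0 <= w%:E)%E) PV; rewrite -EFinM => PV2.
move=> /le_trans/(_ (leeD2l _ PV2)); rewrite -EFinD lee_fin => le2.
have := le_trans (drop n n2) le2; rewrite lerD2l.
have n0 : 0 < n%:R :> R by rewrite ltr0n.
have -> : w * (C / n%:R) = c6 / 2 * (h n `^ r / n%:R).
  by rewrite /w -mulr_natr; field; rewrite !gt_eqF.
rewrite ler_pM2r ?divr_gt0 ?powR_gt0//; apply/negP; rewrite -ltNge.
by rewrite ltr_pdivrMr// ltr_pMr// ltr1n.
Qed.

Lemma inradius_ge : exists2 c8 : R, 0 < c8 & forall n a, (1 <= n)%N ->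
  a \in alpha n -> ((c8 * h n)%:E <= inradius N (alpha n) a)%E.
Proof.
have [c8 c80 sep] := alpha_separated; exists (c8 / 2); first by rewrite divr_gt0.
move=> n a n1 aA; have hn : 0 < h n := @scale_gt0 R d n n1.
apply: ereal_sup_ubound; exists (c8 / 2 * h n) => //; split.
  by rewrite mulr_gt0// divr_gt0.
move=> x; rewrite /norm_ball/= => xs; apply: open_voronoi_sub => //.
apply/open_voronoiP => b bA ba; have := sep n a b n1 aA bA ba.
have := is_norm_distD N_norm x a b; rewrite (is_norm_distC N_norm a x).
move: xs; rewrite [c8 / 2 * _]mulrAC.
move: (c8 * h n) (N (x - a)) (N (x - b)) (N (a - b)) => u v w z; lra.
Qed.

Context (K_conn : connected K).

(** Since the support is connected, it cannot be split into the part served by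
    [a] and the part served by the other points: some point of the support is
    equidistant from [a] and from another nearest point. *)
Lemma voronoi_neighbour n a : (2 <= n)%N -> a \in alpha n ->
  exists x b, [/\ K x, b \in alpha n, b != a &
    D n x = N (x - a) /\ D n x = N (x - b)].
Proof.
move=> n2 aA; have n1 : (1 <= n)%N := ltnW n2.
apply: contrapT => H.
have VV0 x : K x -> voronoi N (alpha n) a x -> open_voronoi N (alpha n) a x.
  move=> Kx /(voronoi_dist n1 aA) E; apply/open_voronoiP => b bA ba.
  rewrite ltNge; apply/negP => le1; apply: H; exists x, b; split=> //.
  by split=> //; apply/eqP; rewrite eq_le cdist_le//= -E.
have KE : K `&` voronoi N (alpha n) a = K.
  apply: K_conn.
  - have [x [Kx Vx]] := open_voronoi_meets_support n2 aA.
    by exists x; split=> //; exact: open_voronoi_sub.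
  - exists (open_voronoi N (alpha n) a); first exact: open_voronoi_open.
    apply/seteqP; split=> x [Kx Vx]; split=> //; first exact: VV0.
    exact: open_voronoi_sub.
  - by exists (voronoi N (alpha n) a) => //; exact: voronoi_closed.
have /fset0Pn[b] := remove_alpha_neq0 n2 aA; rewrite !inE => /andP[ba bA].
have [x [Kx /open_voronoiP Vb]] := open_voronoi_meets_support n2 bA.
have : (K `&` voronoi N (alpha n) a) x by rewrite KE.
move=> [_ /(VV0 x Kx)/open_voronoiP Va].
have ab : a != b by rewrite eq_sym.
by have := lt_trans (Va b bA ba) (Vb a aA ab); rewrite ltxx.
Qed.

Lemma mass_open_voronoi_ge : exists2 c9 : R, 0 < c9 & forall n a, (1 <= n)%N ->
  a \in alpha n -> ((c9 / n%:R)%:E <= P (open_voronoi N (alpha n) a))%E.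
Proof.
have [C5 C50 DC5] := cdist_alpha_le; have [c6 c60 drop] := err_drop_scale_ge.
pose c9 := Num.min 1 (c6 / (C5 *+ 3) `^ r).
have C53 : 0 < C5 *+ 3 by rewrite pmulrn_lgt0.
have c90 : 0 < c9 by rewrite lt_min ltr01/= divr_gt0// powR_gt0.
exists c9 => // n a n1 aA; have hn : 0 < h n := @scale_gt0 R d n n1.
have [n2|] := leqP 2 n; last first.
  (* The open cell of a single point is the whole space. *)
  rewrite ltnS => n1'; have E : n = 1%N by apply/eqP; rewrite eqn_leq n1 n1'.
  rewrite E in aA *; rewrite (_ : open_voronoi _ _ _ = setT).
    by rewrite probability_setT divr1 lee_fin ge_min lexx.
  apply/seteqP; split=> // x _; apply/open_voronoiP => b bA.
  by rewrite (alpha1_eq aA bA) eqxx.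
have [y [b [Ky bA ba [ya yb]]]] := voronoi_neighbour n2 aA.
have ab : N (a - b) <= C5 * h n *+ 2.
  rewrite (le_trans (is_norm_distD N_norm y _ _))// (is_norm_distC N_norm a).
  by rewrite -ya -yb mulr2n lerD// DC5.
pose w := (C5 *+ 3 * h n) `^ r.
have w0 : 0 < w by rewrite powR_gt0// mulr_gt0.
have le1 := @err_remove n a (cst w) n2 aA (remove_alpha_neq0 n2 aA).
have {le1} : ((err n.-1)%:E <= (err n)%:E + w%:E * P (open_voronoi N (alpha n) a))%E.
  rewrite -integral_cst; last exact: open_voronoi_measurable.
  apply: le1 => [|x|x Kx Vx]; [exact: measurable_cst|exact: ltW|].
  apply: (@le_trans _ _ w); last by rewrite lerDr powR_ge0.
  apply: ler_powR_base => //; first exact: cdist_ge0.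
  rewrite (le_trans (cdist_remove_in N_norm aA Vx bA ba))// mulrnAl mulrS.
  by rewrite lerD// DC5.
have fP : P (open_voronoi N (alpha n) a) \is a fin_num.
  by rewrite fin_num_measure//; exact: open_voronoi_measurable.
rewrite -(fineK fP) -EFinM -EFinD !lee_fin => le1.
have := le_trans (drop n n2) le1; rewrite lerD2l => {}le1.
have n0 : 0 < n%:R :> R by rewrite ltr0n.
rewrite -(ler_pM2l w0) (le_trans _ le1)//.
rewrite !mulrA ler_pM2r ?invr_gt0//.
rewrite /w powRM ?(ltW C53) ?(ltW hn)// mulrAC ler_pM2r ?powR_gt0//.
by rewrite mulrC -ler_pdivlMr ?powR_gt0// ge_min lexx orbT.
Qed.

Lemma loss_open_voronoi_ge : exists2 c10 : R, 0 < c10 & forall n a, (1 <= n)%N ->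
  a \in alpha n -> ((c10 * (h n `^ r / n%:R))%:E <=
    \int[P]_(x in open_voronoi N (alpha n) a) (N (x - a) `^ r)%:E)%E.
Proof.
have [c9 c90 mass] := mass_open_voronoi_ge.
pose t := Num.min 1 (c9 / (M *+ 2)).
have M2 : 0 < M *+ 2 by rewrite pmulrn_lgt0.
have t0 : 0 < t by rewrite lt_min ltr01/= divr_gt0.
have Mt : M * t ^+ d <= c9 / 2.
  apply: (@le_trans _ _ (M * t)).
    rewrite ler_wpM2l ?(ltW M_gt0)//.
    case: d d_gt0 => // k _; rewrite exprS ler_piMr ?(ltW t0)//.
    by rewrite exprn_ile1// ?(ltW t0)// ge_min lexx.
  have -> : c9 / 2 = M * (c9 / (M *+ 2)).
    by rewrite -mulr_natr; field; rewrite gt_eqF.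
  by rewrite ler_pM2l// ge_min lexx orbT.
exists (t `^ r * (c9 / 2)); first by rewrite mulr_gt0 ?powR_gt0// divr_gt0.
move=> n a n1 aA; have hn : 0 < h n := @scale_gt0 R d n n1.
have n0 : 0 < n%:R :> R by rewrite ltr0n.
have th : 0 < t * h n := mulr_gt0 t0 hn.
set V := open_voronoi N (alpha n) a.
have mV : measurable V := open_voronoi_measurable _ _.
(* The part of the cell at distance at least [t * h n] from [a] keeps half of
   the guaranteed mass. *)
pose B := V `\` norm_ball N a (t * h n).
have mB : measurable B by apply: measurableD => //; exact: measurable_norm_ball.
have PB : ((c9 / 2 / n%:R)%:E <= P B)%E.
  have : (P V <= P B + P (norm_ball N a (t * h n)))%E.
    apply: (@le_trans _ _ (P (B `|` norm_ball N a (t * h n)))).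
      apply: le_measure; rewrite ?inE//.
        by apply: measurableU => //; exact: measurable_norm_ball.
      move=> x Vx; have [?|?] := pselect (norm_ball N a (t * h n) x).
        by right.
      by left.
    by apply: measureU2 => //; exact: measurable_norm_ball.
  move=> /(le_trans (mass n a n1 aA)) le1.
  have := le_trans le1 (leeD2l _ (P_ball_le a (ltW th))).
  rewrite -[P B]fineK ?fin_num_measure// -EFinD !lee_fin exprMn scaleX//.
  have : M * (t ^+ d / n%:R) <= c9 / 2 / n%:R.
    by rewrite mulrA ler_pM2r ?invr_gt0.
  have -> : c9 / n%:R = c9 / 2 / n%:R + c9 / 2 / n%:R.
    by rewrite -mulrDl -splitr.
  move: (fine _) (c9 / 2 / n%:R) (M * _) => u v w; lra.
have le1 := @ge0_integral_set_ge _ _ _ P K ae_msupport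
  (fun x => N (x - a) `^ r) ((t * h n) `^ r) B V.
apply: le_trans (le1 _ _ _ _ _ _ _) => //.
- have -> : t `^ r * (c9 / 2) * (h n `^ r / n%:R) =
      (t * h n) `^ r * (c9 / 2 / n%:R).
    by rewrite powRM ?(ltW t0) ?(ltW hn)//; ring.
  by rewrite EFinM lee_wpmul2l// lee_fin powR_ge0.
- exact: measurable_dist_powR.
- by move=> x; exact: powR_ge0.
- exact: powR_ge0.
- by move=> x [].
- move=> x _ [_ xB]; apply: ler_powR_base => //; first exact: ltW.
  by rewrite leNgt; apply/negP.
Qed.

(** With at least two points, the inradius of a cell is at most half the
    distance to another point [b] of the codebook (test the segment from [a] to
    [b]). Choosing [b] such that some [x] in the support is equidistant from [a]
    and [b], this is at most [N (x - a)], which the circumradius bounds. *)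
Lemma inradius_le_circumradius n a : (2 <= n)%N -> a \in alpha n ->
  (inradius N (alpha n) a <= circumradius N P (alpha n) a)%E.
Proof.
move=> n2 aA; have n1 : (1 <= n)%N := ltnW n2.
have [x [b [Kx bA ba [xa xb]]]] := voronoi_neighbour n2 aA.
apply: ge_ereal_sup => _ [s [s_gt0 sV] <-].
apply: le_ereal_inf_tmp => _ [t [t_gt0 tV] <-]; rewrite lee_fin.
have xt : N (x - a) < t by apply: tV; split=> //; exact/voronoiP.
set D0 := N (b - a).
have D0_gt0 : 0 < D0 by exact: is_norm_dist_gt0.
have s2 : s *+ 2 <= D0.
  rewrite leNgt; apply/negP => lt.
  have [sD|Ds] := leP s D0; last first.
    have /(voronoi_dist n1 aA) E : voronoi N (alpha n) a b by exact: sV.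
    have := cdist_le N b bA; rewrite -E is_norm_distxx//.
    by apply/negP; rewrite -ltNge.
  (* The point [a + th (b - a)] lies in the ball of radius [s] but, as
     [th > 1 / 2], is nearer to [b] than to [a]. *)
  pose th := (2^-1 + s / D0) / 2.
  have sD1 : s / D0 <= 1 by rewrite ler_pdivrMr// mul1r.
  have sD2 : 2^-1 < s / D0.
    by rewrite ltr_pdivlMr// mulrC ltr_pdivrMr// mulr_natr.
  have th1 : 2^-1 < th by rewrite /th; move: sD2; move: (s / D0) => u; lra.
  have th2 : th < 1 by rewrite /th; move: sD1; move: (s / D0) => u; lra.
  have th3 : th * D0 < s.
    rewrite -ltr_pdivlMr// /th; move: sD2; move: (s / D0) => u; lra.
  pose y := a + th *: (b - a).
  have ya : N (y - a) = th * D0.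
    rewrite /y [a + _]addrC addrK (is_norm_homogeneous N_norm) ger0_norm//.
    by apply: ltW; apply: lt_trans th1; rewrite invr_gt0.
  have yb : N (y - b) = (1 - th) * D0.
    have -> : y - b = (th - 1) *: (b - a).
      by rewrite /y scalerBl scale1r opprB addrCA addrA.
    by rewrite (is_norm_homogeneous N_norm) distrC ger0_norm// subr_ge0 ltW.
  have /(voronoi_dist n1 aA) E : voronoi N (alpha n) a y.
    by apply: sV; rewrite /norm_ball/= ya.
  have := cdist_le N y bA; rewrite -E ya yb ler_pM2r//.
  by move: th1; lra.
apply: ltW; apply: le_lt_trans xt.
have := is_norm_distD N_norm x b a; rewrite (is_norm_distC N_norm b x) -xb xa -/D0.
move: s2; rewrite mulr2n; move: (N _) D0 {D0_gt0} => u v; lra.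
Qed.

End optimal_codebooks.

(** * Comparison of sequences *)

(** Real bounds suffice for [preceq]; the denominators [b n] may be infinite. *)
Lemma preceq_of_bounds {R : realType} (a b : nat -> \bar R) (x y : nat -> R)
    (C : R) : 0 <= C ->
  (forall n, (0 < n)%N -> (a n <= (x n)%:E)%E) ->
  (forall n, (0 < n)%N -> 0 < y n /\ ((y n)%:E <= b n)%E) ->
  (forall n, (0 < n)%N -> x n <= C * y n) -> preceq a b.
Proof.
move=> C0 ax yb xy; exists C => n n0; have [y0 ybn] := yb n n0.
case: (b n) ybn => [z| |] //; last by rewrite invey mule0 lee_fin.
rewrite lee_fin => yz; have z0 := lt_le_trans y0 yz.
rewrite inver gt_eqF// lee_pdivrMr// (le_trans (ax n n0))// -EFinM lee_fin.
by rewrite (le_trans (xy n n0))// ler_wpM2l.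
Qed.

Section extrema_over_codebook.
Context {R : realType} {d : nat}.
Implicit Types (A : {fset 'rV[R]_d}) (F G : 'rV[R]_d -> \bar R) (m : R).

Lemma min_over_ge A F m : (forall a, a \in A -> (m%:E <= F a)%E) ->
  (m%:E <= min_over A F)%E.
Proof.
by move=> H; rewrite /min_over big_seq; apply: le_bigmin => //; exact: leey.
Qed.

Lemma max_over_le A F m : (forall a, a \in A -> (F a <= m%:E)%E) ->
  (max_over A F <= m%:E)%E.
Proof.
move=> H; rewrite /max_over big_seq; elim/big_ind : _ => //.
  by rewrite leNye.
by move=> x y xm ym; rewrite ge_max xm.
Qed.

Lemma min_over_le_max_over A F G : A != fset0 ->
  (forall a, a \in A -> (F a <= G a)%E) -> (min_over A F <= max_over A G)%E.
Proof.
move=> /fset0Pn[a aA] FG; apply: (@le_trans _ _ (F a)).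
  exact: ge_bigmin_seq.
by apply: le_trans (FG a aA) _; exact: le_bigmax_seq.
Qed.

End extrema_over_codebook.

Unset Implicit Arguments.

Theorem theorem3p1 (R : realType) (d : nat) (d_ge1 : (1 <= d)%N)
    (N : 'rV[R]_d -> R) (N_norm : is_norm N)
    (r : R) (r_gt0 : 0 < r)
    (P : probability 'rV[R]_d R)
    (f : 'rV[R]_d -> R)
    (f_meas : measurable_fun [set: 'rV[R]_d] f)
    (f_ge0 : forall x, 0 <= f x)
    (P_density : forall A : set 'rV[R]_d, measurable A ->
      P A = (\int[@lebesgue_measure_rV R d]_(x in A) (f x)%:E)%E)
    (f_bounded : (ess_sup (@lebesgue_measure_rV R d) (EFin \o f) < +oo)%E)
    (supp_connected : connected (msupport P))
    (supp_compact : compact (msupport P))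
    (P_peakless : peakless N P)
    (alpha : nat -> {fset 'rV[R]_d})
    (alpha_opt : forall n, (1 <= n)%N -> optimal_codebook N P r n (alpha n)) :
  let V n a := voronoi N (alpha n) a in
  let V0 n a := open_voronoi N (alpha n) a in
  let mass_min n := min_over (alpha n) (fun a => P (V0 n a)) in
  let mass_max n := max_over (alpha n) (fun a => P (V n a)) in
  let loss_min n := min_over (alpha n)
    (fun a => (\int[P]_(x in V0 n a) ((N (x - a)) `^ r)%:E)%E) in
  let loss_max n := max_over (alpha n)
    (fun a => (\int[P]_(x in V n a) ((N (x - a)) `^ r)%:E)%E) in
  let radius_min n := min_over (alpha n) (inradius N (alpha n)) in
  let radius_max n := max_over (alpha n) (circumradius N P (alpha n)) in
  let inv n : \bar R := (n%:R^-1)%:E in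
  let loss_avg n := (quantization_error_pow N P r n * inv n)%E in
  let scale n : \bar R := (n%:R `^ (- d%:R^-1))%:E in
  [/\ [/\ preceq inv mass_min,
          forall n, (1 <= n)%N -> (mass_min n <= mass_max n)%E
        & preceq mass_max inv],
      [/\ preceq loss_avg loss_min,
          forall n, (1 <= n)%N -> (loss_min n <= loss_max n)%E
        & preceq loss_max loss_avg]
    & [/\ preceq scale radius_min,
          forall n, (2 <= n)%N -> (radius_min n <= radius_max n)%E
        & preceq radius_max scale]].
Proof.
have [M M_gt0 P_ball_le] :=
  bounded_density_ball N_norm f_meas f_ge0 P_density f_bounded.
have [c [s0 [c_gt0 s0_gt0 P_ball_ge]]] := peakless_ball N_norm P_peakless.
have [k0 Kk0] : exists k0, msupport P k0.
  apply: contrapT => /forallNP K0; have := msupport_full P.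
  rewrite (_ : ~` msupport P = setT); last first.
    by apply/seteqP; split => // x _; exact: K0.
  by rewrite probability_setT => /eqP; rewrite onee_eq0.
have [L L_gt0 K_sub] : exists2 L : R, 0 < L &
    forall x, msupport P x -> N (x - k0) <= L.
  have [|x xK xmax] := EVT_max_rV (f := fun x => N (x - k0)) _ supp_compact
      (continuous_subspaceT (dist_norm_continuous N_norm (a := k0))).
    by exists k0.
  exists (N (x - k0) + 1); first by rewrite ltr_wpDl// is_norm_ge0.
  by move=> y Ky; rewrite (le_trans (xmax y (mem_set Ky)))// lerDl.
have A0 := alpha_neq0 N_norm r_gt0 K_sub alpha_opt.
have EE := errE N_norm r_gt0 K_sub alpha_opt.
have [C1 C10 err_ub] := err_le_scale d_ge1 N_norm r_gt0 L_gt0 K_sub alpha_opt.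
have [c2 c20 err_lb] :=
  err_ge d_ge1 N_norm r_gt0 K_sub M_gt0 P_ball_le alpha_opt.
have [c9 c90 mass_lb] := mass_open_voronoi_ge d_ge1 N_norm r_gt0 L_gt0 K_sub
  M_gt0 P_ball_le c_gt0 s0_gt0 P_ball_ge alpha_opt supp_connected.
have [Cm Cm0 mass_ub] := mass_voronoi_le d_ge1 N_norm r_gt0 L_gt0 K_sub
  M_gt0 P_ball_le c_gt0 s0_gt0 P_ball_ge alpha_opt.
have [c10 c100 loss_lb] := loss_open_voronoi_ge d_ge1 N_norm r_gt0 L_gt0 K_sub
  M_gt0 P_ball_le c_gt0 s0_gt0 P_ball_ge alpha_opt supp_connected.
have [Cl Cl0 loss_ub] := loss_voronoi_le d_ge1 N_norm r_gt0 L_gt0 K_sub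
  M_gt0 P_ball_le c_gt0 s0_gt0 P_ball_ge alpha_opt.
have [c8 c80 rad_lb] := inradius_ge d_ge1 N_norm r_gt0 L_gt0 K_sub
  M_gt0 P_ball_le c_gt0 s0_gt0 P_ball_ge alpha_opt.
have [Cr Cr0 rad_ub] := circumradius_le d_ge1 N_norm r_gt0 L_gt0 K_sub
  c_gt0 s0_gt0 P_ball_ge alpha_opt.
have in_circ := inradius_le_circumradius d_ge1 N_norm r_gt0 L_gt0 K_sub
  M_gt0 P_ball_le c_gt0 s0_gt0 P_ball_ge alpha_opt supp_connected.
pose h n : R := scale d n.
have h0 n (n0 : (0 < n)%N) : 0 < h n by rewrite /h scale_gt0.
have n_gt0 n : (0 < n)%N -> 0 < n%:R :> R by rewrite ltr0n.
have hr0 n : (0 < n)%N -> 0 < h n `^ r / n%:R.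
  by move=> n0; rewrite divr_gt0 ?n_gt0// powR_gt0// h0.
move=> V V0 mass_min mass_max loss_min loss_max radius_min radius_max inv
  loss_avg sc.
have avgE n : (0 < n)%N -> loss_avg n = (err N r P n / n%:R)%:E.
  by move=> n0; rewrite /loss_avg EE.
split; split.
- apply: (@preceq_of_bounds _ _ _ (fun n => n%:R^-1) (fun n => c9 / n%:R) c9^-1).
  + by rewrite invr_ge0 ltW.
  + by [].
  + move=> n n0; split; first by rewrite divr_gt0// n_gt0.
    by apply: min_over_ge => a; exact: mass_lb.
  + by move=> n n0; rewrite mulKf// gt_eqF.
- move=> n n1; apply: min_over_le_max_over; first exact: A0.
  move=> a aA; apply: le_measure; rewrite ?inE.
  + exact: open_voronoi_measurable.
  + exact: voronoi_measurable.
  + exact: open_voronoi_sub.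
- apply: (@preceq_of_bounds _ _ _ (fun n => Cm / n%:R) (fun n => n%:R^-1) Cm).
  + exact: ltW.
  + by move=> n n0; apply: max_over_le => a; exact: mass_ub.
  + by move=> n n0; rewrite invr_gt0 n_gt0.
  + by [].
- apply: (@preceq_of_bounds _ _ _ (fun n => C1 * (h n `^ r / n%:R))
    (fun n => c10 * (h n `^ r / n%:R)) (C1 / c10)).
  + by rewrite divr_ge0// ltW.
  + move=> n n0; rewrite avgE// lee_fin mulrA ler_pM2r ?invr_gt0 ?n_gt0//.
    exact: err_ub.
  + move=> n n0; split; first by rewrite mulr_gt0 ?hr0.
    by apply: min_over_ge => a; exact: loss_lb.
  + by move=> n n0; rewrite [leRHS]mulrA divfK// gt_eqF.
- move=> n n1; apply: min_over_le_max_over; first exact: A0.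
  move=> a aA; apply: ge0_subset_integral.
  + exact: open_voronoi_measurable.
  + exact: voronoi_measurable.
  + apply: measurable_funTS; apply/measurable_EFinP.
    exact: measurable_dist_powR.
  + by move=> x _; rewrite lee_fin powR_ge0.
  + exact: open_voronoi_sub.
- apply: (@preceq_of_bounds _ _ _ (fun n => Cl * (h n `^ r / n%:R))
    (fun n => c2 * (h n `^ r / n%:R)) (Cl / c2)).
  + by rewrite divr_ge0// ltW.
  + by move=> n n0; apply: max_over_le => a; exact: loss_ub.
  + move=> n n0; split; first by rewrite mulr_gt0 ?hr0.
    rewrite avgE// lee_fin mulrA ler_pM2r ?invr_gt0 ?n_gt0//.
    exact: err_lb.
  + by move=> n n0; rewrite [leRHS]mulrA divfK// gt_eqF.
- apply: (@preceq_of_bounds _ _ _ h (fun n => c8 * h n) c8^-1).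
  + by rewrite invr_ge0 ltW.
  + by [].
  + move=> n n0; split; first by rewrite mulr_gt0 ?h0.
    by apply: min_over_ge => a; exact: rad_lb.
  + by move=> n n0; rewrite mulKf// gt_eqF.
- move=> n n2; apply: min_over_le_max_over; first exact: A0 (ltnW n2).
  by move=> a; exact: in_circ.
- apply: (@preceq_of_bounds _ _ _ (fun n => Cr * h n) h Cr).
  + exact: ltW.
  + by move=> n n0; apply: max_over_le => a; exact: rad_ub.
  + by move=> n n0; split; first exact: h0.
  + by [].
Qed.
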